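(* Let $W$ be a recurrent infinite word, $S$ a Rauzy scheme for $W$, and $v$ a support edge of $S$; construct the graphs $S'$ and $S''$ as described in the context. Then $S''$ is strongly connected. If $S''$ is a cycle, then $W$ is periodic. If $S''$ is not a cycle, then $S''$, equipped with the words described in the context, is a Rauzy scheme for $W$ (it is called the elementary evolution of $S$ along $v$).
   Context: An infinite word is recurrent if every factor occurs infinitely often, and periodic if it equals $uuu\cdots$ for a nonempty finite word $u$. $u\sqsubseteq w$: $u$ is a factor of $w$; $u\sqsubseteq_k w$: $u$ occurs in $w$ at least $k$ times. A graph with words is a strongly connected finite directed graph (multiple edges and loops allowed) in which every edge $e$ carries a front word $F(e)$ and a back word $B(e)$, and every vertex either has in-degree $1$ and out-degree $>1$ (distributing vertex) or in-degree $>1$ and out-degree $1$ (collecting vertex). A path is a finite nonempty sequence of edges $v_1\dots v_n$ with each $v_{i+1}$ starting where $v_i$ ends; subpaths and $s_1\sqsubseteq_k s_2$ are defined via edge records. A path is symmetric if its first edge starts at a collecting vertex and its last edge ends at a distributing vertex. For $s=v_1\dots v_n$, $F(s)$ is the concatenation, in order, of the front words of $v_1$ and of all $v_i$ ($i\ge2$) starting at a distributing vertex; $B(s)$ is the concatenation, in order, of the back words of all $v_i$ ($i\le n-1$) ending at a collecting vertex and of $v_n$. A Rauzy scheme for $W$ is a graph with words such that: (1) it has more than one edge; (2) front words of edges leaving a common distributing vertex have pairwise distinct first letters, and back words of edges entering a common collecting vertex have pairwise distinct last letters; (3) $F(s)=B(s)$ for every symmetric path $s$; (4) for symmetric paths $s_1,s_2$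 and $k\ge1$, $F(s_1)\sqsubseteq_k F(s_2)$ implies $s_1\sqsubseteq_k s_2$; (5) all words on edges are factors of $W$; (6) every factor of $W$ is a factor of $F(s)$ for some symmetric path $s$; (7) for every edge $e$ there is a factor $u_e$ of $W$ such that every symmetric path $s$ with $u_e\sqsubseteq F(s)$ passes through $e$. A support edge is an edge going from a collecting vertex to a distributing vertex; for it $F(v)=B(v)=:V$. In a strongly connected directed graph that is not a cycle and whose vertices are all distributing or collecting, the natural right extension of a path $s$ is the shortest path having $s$ as a prefix and ending at a distributing vertex, and the natural left extension is the shortest path having $s$ as a suffix and starting at a collecting vertex. Construction. Let $x_1,\dots,x_p$ be the edges entering the start of $v$ and $y_1,\dots,y_q$ the edges leaving the end of $v$; put $X_i=B(x_i)$, $Y_j=F(y_j)$. The pair $(i,j)$ is good if $X_iVY_j\sqsubseteq W$ and bad otherwise. The graph $S'$ is obtained from $S$ by deleting $v$, replacing its start by $p$ vertices $A_1,\dots,A_p$ with $x_i$ entering $A_i$, replacing its end by $q$ vertices $B_1,\dots,B_q$ with $y_j$ leaving $B_j$, and adding edges $v_{ij}\colon A_i\to B_j$ for all $i,j$. Words in $S'$: the front word of $y_j$ is $VY_j$, the back word of $x_i$ is $X_iV$, the front word of $v_{ij}$ is $Y_j$ and its back word is $X_i$; all other front and back words are copied from $S$. The edges $v_{ij}$ with $(i,j)$ bad are bad; all other edges of $S'$ are good. A vertex of $S'$ is persistent if at least two good edges leave it or at least two good edges enter it. The vertices of $S''$ are the persistent vertices of $S'$, and the edges of $S''$ correspond to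 paths in $S'$ consisting of good edges, starting and ending at persistent vertices, with no persistent interior vertex. If $S''$ is not a cycle, the front word of an edge $e$ of $S''$ is $F$ (computed in $S'$) of the path of $S'$ corresponding to the natural right extension of $e$ in $S''$, and its back word is $B$ (computed in $S'$) of the path of $S'$ corresponding to the natural left extension of $e$ in $S''$. *)

(* Defs.v *)
From Stdlib Require Import ClassicalEpsilon.
From HB Require Import structures.
From mathcomp Require Import all_boot.

Set Implicit Arguments.
Unset Strict Implicit.
Unset Printing Implicit Defensive.

Definition pb (P : Prop) : bool :=
  if excluded_middle_informative P then true else false.

Section Words.
Variable A : eqType.

Definition subw (W : nat -> A) (i n : nat) : seq A := mkseq (fun j => W (i + j)) n.

Definition factorW (u : seq A) (W : nat -> A) : Prop := exists i, subw W i (size u) = u.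

Definition recurrent (W : nat -> A) : Prop :=
  forall u, factorW u W -> forall n, exists i, n <= i /\ subw W i (size u) = u.

Definition periodic (W : nat -> A) : Prop :=
  exists u : seq A, u <> [::] /\ forall i, W i = nth (W 0) u (i %% size u).
End Words.

Definition occ (T : eqType) (u w : seq T) : nat :=
  count (fun i => take (size u) (drop i w) == u) (iota 0 (size w - size u).+1).

Definition finite_type (T : eqType) : Prop := exists s : seq T, forall x : T, x \in s.

Record graph (V E : Type) := Graph { src : E -> V; tgt : E -> V }.
Record gwords (A V E : Type) := GW { gr : graph V E; front : E -> seq A; back : E -> seq A }.

Section Graphs.
Variables (V E : eqType) (G : graph V E).

Definition is_path (s : seq E) : bool :=
  if s is e :: s' then path (fun a b => tgt G a == src G b) e s' else false.

Definition path_from_to (s : seq E) (x y : V) : Prop :=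
  match s with
  | e :: s' => [/\ is_path s, src G e = x & tgt G (last e s') = y]
  | [::] => False
  end.

Definition strongly_connected : Prop :=
  forall x y : V, x = y \/ exists s, path_from_to s x y.

Definition in_one (x : V) : Prop :=
  exists e, tgt G e = x /\ forall e', tgt G e' = x -> e' = e.
Definition out_one (x : V) : Prop :=
  exists e, src G e = x /\ forall e', src G e' = x -> e' = e.
Definition in_many (x : V) : Prop :=
  exists e1 e2, e1 <> e2 /\ tgt G e1 = x /\ tgt G e2 = x.
Definition out_many (x : V) : Prop :=
  exists e1 e2, e1 <> e2 /\ src G e1 = x /\ src G e2 = x.

Definition distributing (x : V) : Prop := in_one x /\ out_many x.
Definition collecting (x : V) : Prop := in_many x /\ out_one x.

Definition graph_ok : Prop :=
  [/\ finite_type V, finite_type E, strongly_connected &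
      forall x, distributing x \/ collecting x].

Definition is_cycle : Prop :=
  strongly_connected /\ forall x, in_one x /\ out_one x.

Definition symmetric (s : seq E) : Prop :=
  match s with
  | e :: s' => [/\ is_path s, collecting (src G e) & distributing (tgt G (last e s'))]
  | [::] => False
  end.

Definition natRext (e : E) (s : seq E) : Prop :=
  exists s', [/\ s = e :: s', is_path s, distributing (tgt G (last e s')) &
    forall t', is_path (e :: t') -> distributing (tgt G (last e t')) -> size s' <= size t'].

Definition natLext (e : E) (s : seq E) : Prop :=
  exists s', [/\ s = rcons s' e, is_path s, collecting (src G (head e s')) &
    forall t', is_path (rcons t' e) -> collecting (src G (head e t')) -> size s' <= size t'].

Definition support_edge (e : E) : Prop := collecting (src G e) /\ distributing (tgt G e).
End Graphs.

Section Scheme.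
Variables (A V E : eqType) (S : gwords A V E).
Let G := gr S.

Definition Fw (s : seq E) : seq A :=
  match s with
  | e :: s' => front S e ++ flatten [seq front S f | f <- s' & pb (distributing G (src G f))]
  | [::] => [::]
  end.

Definition Bw (s : seq E) : seq A :=
  match s with
  | e :: s' => flatten [seq back S f | f <- belast e s' & pb (collecting G (tgt G f))]
               ++ back S (last e s')
  | [::] => [::]
  end.

Definition rauzy_scheme (W : nat -> A) : Prop :=
  [/\ graph_ok G /\
  (* (1) *) (exists e1 e2 : E, e1 <> e2),
  (* (2) *) (forall x e1 e2, distributing G x -> e1 <> e2 -> src G e1 = x -> src G e2 = x ->
               exists a1 w1 a2 w2, [/\ front S e1 = a1 :: w1, front S e2 = a2 :: w2 & a1 <> a2])
         /\ (forall x e1 e2, collecting G x -> e1 <> e2 -> tgt G e1 = x -> tgt G e2 = x ->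
               exists a1 w1 a2 w2, [/\ back S e1 = rcons w1 a1, back S e2 = rcons w2 a2 & a1 <> a2]),
  (* (3) *) (forall s, symmetric G s -> Fw s = Bw s),
  (* (4) *) (forall s1 s2 k, symmetric G s1 -> symmetric G s2 -> 1 <= k ->
               k <= occ (Fw s1) (Fw s2) -> k <= occ s1 s2) &
  [/\ (* (5) *) (forall e, factorW (front S e) W /\ factorW (back S e) W),
      (* (6) *) (forall u, factorW u W -> exists s, symmetric G s /\ infix u (Fw s)) &
      (* (7) *) (forall e, exists u, factorW u W /\
                   forall s, symmetric G s -> infix u (Fw s) -> e \in s)]].
End Scheme.

Section Evolution.
Variables (A : eqType) (V E : finType) (S : gwords A V E) (W : nat -> A) (v : E).
Let G := gr S.

(* vertices of S': old vertices (inl x), A_e := inr (inl e) for an edge e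
   entering src v, B_e := inr (inr e) for an edge e leaving tgt v.  Vertices
   not incident to any edge of S' (e.g. the old src v, tgt v) are isolated,
   hence never persistent. *)
Definition V1 : finType := (V + (E + E))%type.

(* edges of S': the old edges other than v, and v_{ij} = (x_i, y_j) *)
Definition E1 : finType :=
  ({e : E | e != v} +
   {p : E * E | (tgt G p.1 == src G v) && (src G p.2 == tgt G v)})%type.

Definition src1 (e : E1) : V1 :=
  match e with
  | inl e => if src G (val e) == tgt G v then inr (inr (val e)) else inl (src G (val e))
  | inr p => inr (inl (val p).1)
  end.

Definition tgt1 (e : E1) : V1 :=
  match e with
  | inl e => if tgt G (val e) == src G v then inr (inl (val e)) else inl (tgt G (val e))
  | inr p => inr (inr (val p).2)
  end.

Definition S1graph : graph V1 E1 := Graph src1 tgt1.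

(* V = F(v) = B(v) *)
Definition Vword : seq A := front S v.

Definition front1 (e : E1) : seq A :=
  match e with
  | inl e => if src G (val e) == tgt G v then Vword ++ front S (val e) else front S (val e)
  | inr p => front S (val p).2
  end.

Definition back1 (e : E1) : seq A :=
  match e with
  | inl e => if tgt G (val e) == src G v then back S (val e) ++ Vword else back S (val e)
  | inr p => back S (val p).1
  end.

Definition S1 : gwords A V1 E1 := GW S1graph front1 back1.

Definition good1 (e : E1) : bool :=
  match e with
  | inl _ => true
  | inr p => pb (factorW (back S (val p).1 ++ Vword ++ front S (val p).2) W)
  end.

Definition persistent (x : V1) : bool :=
  (1 < #|[pred e : E1 | good1 e && (src1 e == x)]|) ||
  (1 < #|[pred e : E1 | good1 e && (tgt1 e == x)]|).

Definition S2edge (s : seq E1) : bool :=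
  match s with
  | e :: s' => [&& is_path S1graph s, all good1 s, persistent (src1 e),
                persistent (tgt1 (last e s')) & all (fun f => ~~ persistent (src1 f)) s']
  | [::] => false
  end.

Definition V2 : finType := {x : V1 | persistent x}.
Definition E2 : eqType := {s : seq E1 | S2edge s}.

Definition hsrc (s : seq E1) : V1 :=
  if s is e :: _ then src1 e else inr (inl v).
Definition ltgt (s : seq E1) : V1 :=
  if s is e :: s' then tgt1 (last e s') else inr (inl v).

Lemma S2edge_src s : S2edge s -> persistent (hsrc s).
Proof. by case: s => //= e s' /and5P[]. Qed.
Lemma S2edge_tgt s : S2edge s -> persistent (ltgt s).
Proof. by case: s => //= e s' /and5P[]. Qed.

Definition src2 (s : E2) : V2 := exist _ (hsrc (val s)) (S2edge_src (valP s)).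
Definition tgt2 (s : E2) : V2 := exist _ (ltgt (val s)) (S2edge_tgt (valP s)).

Definition S2graph : graph V2 E2 := Graph src2 tgt2.

Definition unfold2 (s : seq E2) : seq E1 := flatten [seq val e | e <- s].
End Evolution.

(* Main.v *)
Require Import Defs.
From HB Require Import structures.
From mathcomp Require Import all_boot zify.

(** Forgetting the indices of the v_ij maps S' to S. It identifies symmetric
paths of S' with the symmetric paths of S other than (v), and the words of S'
are chosen so that F and B are preserved; hence S' inherits every property of a
Rauzy scheme, except those that fail because of bad edges. A bad edge is
harmless: a symmetric path through v_ij contains a symmetric path with word
X_i V Y_j, so a symmetric path whose word is a factor of W has good edges only,
and for a good v_ij the factor X_i V Y_j forces the passage through v_ij.

Given factors u_1, u_2 of W, recurrence yields a factor in which they are far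
apart and far from the ends; trimming a symmetric path that carries it gives a
symmetric path whose word is a factor of W and contains u_1, ..., u_2. With
forcing factors for u_1, u_2 this shows that any two good edges are joined by a
good path, which moreover can be taken inside such a path.

If no vertex is persistent, good paths are deterministic, so their words, and
then W, are periodic. Otherwise an edge of S'' is determined by its first edge in S'
(and by its last one), and good paths between persistent vertices are exactly the
unfoldings of paths of S''; F and B of a symmetric path of S'' are F and B of
its unfolding, and the axioms for S'' follow from those for S'. *)

Set Implicit Arguments.
Unset Strict Implicit.
Unset Printing Implicit Defensive.

Local Notation symmetric := Defs.symmetric.

(** * Sequences and factors *)

Lemma pbP (P : Prop) : reflect P (pb P).
Proof.
by rewrite /pb; case: ClassicalEpsilon.excluded_middle_informative => h; constructor.
Qed.

Section Sequences.
Variable T : eqType.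
Implicit Types (u w s : seq T) (p : pred T).

Lemma split_first p s : has p s ->
  exists s1 x s2, [/\ s = s1 ++ x :: s2, p x & all (predC p) s1].
Proof.
elim: s => //= y s IH; case: (boolP (p y)) => [py _ | npy /= /IH].
  by exists [::], y, s.
by move=> [s1 [x [s2 [-> px ns1]]]]; exists (y :: s1), x, s2; rewrite /= npy.
Qed.

Lemma split_last p s : has p s ->
  exists s1 x s2, [/\ s = s1 ++ x :: s2, p x & all (predC p) s2].
Proof.
elim: s => //= y s IH; case: (boolP (has p s)) => [/IH | ns].
  by move=> [s1 [x [s2 [-> px ns2]]]] _; exists (y :: s1), x, s2.
by rewrite orbF => py; exists [::], y, s; rewrite all_predC.
Qed.

Lemma infix_mid s1 u s2 : infix u (s1 ++ u ++ s2).
Proof. by apply/infixP; exists s1, s2. Qed.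

(** Levi's lemma, for comparing two factorizations of one word. *)
Lemma cat_inj_size s1 s2 t1 t2 : s1 ++ s2 = t1 ++ t2 :> seq T -> size s1 <= size t1 ->
  exists r, t1 = s1 ++ r /\ s2 = r ++ t2.
Proof.
move=> e le; exists (drop (size s1) t1).
have e1 : take (size s1) t1 = s1.
  by rewrite -(takel_cat t2 le) -e take_size_cat.
rewrite -{1}e1 cat_take_drop; split => //.
have -> : s2 = drop (size s1) (t1 ++ t2) by rewrite -e drop_size_cat.
rewrite drop_cat; case: ltnP => // h.
by have -> : size s1 = size t1; [lia | rewrite subnn drop0 drop_size].
Qed.

(** The positions counted by [occ]; as a duplicate-free list they can be compared through maps of
    positions. *)
Definition occurrences u w : seq nat :=
  [seq i <- iota 0 (size w - size u).+1 | take (size u) (drop i w) == u].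

Lemma occurrencesP u w i :
  reflect (exists s1 s2, w = s1 ++ u ++ s2 /\ size s1 = i) (i \in occurrences u w).
Proof.
rewrite mem_filter mem_iota; apply: (iffP andP) => [[/eqP h lei] | [s1 [s2 [-> <-]]]].
  exists (take i w), (drop (size u) (drop i w)); split.
    by rewrite -{1}h !cat_take_drop.
  have := congr1 size h; rewrite size_take_min size_drop size_take_min; lia.
by rewrite drop_size_cat // take_size_cat // eqxx !size_cat; split=> //; lia.
Qed.

Lemma occE u w : occ u w = size (occurrences u w).
Proof. by rewrite /occ size_filter. Qed.

Lemma occ_gt0 u w : (0 < occ u w) = infix u w.
Proof.
rewrite occE -has_predT; apply/hasP/infixP => [[i /occurrencesP[s1 [s2 [-> _]]] _] | [s1 [s2 ->]]].
  by exists s1, s2.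
by exists (size s1) => //; apply/occurrencesP; exists s1, s2.
Qed.
End Sequences.

(** Each occurrence of [u] in [w] yields one of [u'] in [w'] from whose position [g] recovers the
    original one, so distinct occurrences stay distinct. *)
Lemma occ_leq (T T' : eqType) (u w : seq T) (u' w' : seq T') (g : nat -> nat) :
  (forall s1 s2, w = s1 ++ u ++ s2 ->
     exists t1 t2, w' = t1 ++ u' ++ t2 /\ g (size t1) = size s1) ->
  occ u w <= occ u' w'.
Proof.
move=> h; rewrite !occE -(size_map g (occurrences u' w')); apply: uniq_leq_size.
  by rewrite /occurrences filter_uniq ?iota_uniq.
move=> i /occurrencesP[s1 [s2 [/h[t1 [t2 [e <-]]] <-]]].
by apply: map_f; apply/occurrencesP; exists t1, t2.
Qed.

(** * Factors of an infinite word *)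

Section Factors.
Variables (A : eqType) (W : nat -> A).

Lemma size_subw i n : size (subw W i n) = n.
Proof. by rewrite size_mkseq. Qed.

Lemma nth_subw x i n j : j < n -> nth x (subw W i n) j = W (i + j).
Proof. exact: nth_mkseq. Qed.

Lemma subw_cat i n m : subw W i (n + m) = subw W i n ++ subw W (i + n) m.
Proof.
apply: (@eq_from_nth _ (W 0)); rewrite ?size_cat !size_subw // => j ltj.
rewrite nth_cat size_subw nth_subw //; case: ltnP => h; rewrite nth_subw //; last by lia.
by congr W; lia.
Qed.

Lemma factor_subw i n : factorW (subw W i n) W.
Proof. by exists i; rewrite size_subw. Qed.

Lemma factorW_infix u w : infix u w -> factorW w W -> factorW u W.
Proof.
move=> /infixP[s1 [s2 ->]] [i]; rewrite !size_cat !subw_cat => /eqP.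
rewrite eqseq_cat ?size_subw // => /andP[_]; rewrite eqseq_cat ?size_subw // => /andP[/eqP e _].
by exists (i + size s1).
Qed.
End Factors.

(** * Walks and their words *)

Section Walks.
Variables (V E : eqType) (G : graph V E).
Implicit Types (s t : seq E) (e f : E) (P : V -> Prop).

Definition adjacent : rel E := fun e f => tgt G e == src G f.
(** Unlike [is_path], this accepts the empty sequence and so passes to all pieces of a
    concatenation; [starts] and [ends] fail on the empty sequence instead. *)
Definition walk s : bool := sorted adjacent s.
Definition starts P s : Prop := if s is e :: _ then P (src G e) else False.
Definition ends P s : Prop := if s is e :: s' then P (tgt G (last e s')) else False.

Lemma is_pathE s : is_path G s = (s != [::]) && walk s.
Proof. by case: s. Qed.

Lemma symmetricE s :
  symmetric G s <-> [/\ walk s, starts (collecting G) s & ends (distributing G) s].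
Proof. by case: s => // ; split=> // -[]. Qed.

Lemma symmetric_neq0 s : symmetric G s -> s <> [::].
Proof. by case: s. Qed.

Lemma starts_cat P s t : s <> [::] -> starts P (s ++ t) = starts P s.
Proof. by case: s. Qed.

Lemma ends_rcons P s e : ends P (rcons s e) = P (tgt G e).
Proof. by case: s => //= f s; rewrite last_rcons. Qed.

Lemma ends_cat P s t : t <> [::] -> ends P (s ++ t) = ends P t.
Proof. by case/lastP: t => // t e _; rewrite -rcons_cat !ends_rcons. Qed.

Lemma starts_sub P Q s : (forall x, P x -> Q x) -> starts P s -> starts Q s.
Proof. by case: s => //= e s; apply. Qed.

Lemma ends_sub P Q s : (forall x, P x -> Q x) -> ends P s -> ends Q s.
Proof. by case: s => //= e s; apply. Qed.

Lemma walk_cat s t : walk (s ++ t) -> walk s /\ walk t.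
Proof. by case/cat_sorted2. Qed.

Lemma walk_glue s e f t :
  walk (rcons s e ++ f :: t) = [&& walk (rcons s e), tgt G e == src G f & walk (f :: t)].
Proof.
by case: s => [|g s] //=; rewrite cat_path /= last_rcons.
Qed.

Lemma walk_rcons2 s e f : walk (rcons (rcons s e) f) = walk (rcons s e) && (tgt G e == src G f).
Proof. by rewrite -[rcons (rcons s e) f]cats1 walk_glue andbT. Qed.

Lemma walk_join s t P : walk (s ++ t) -> s <> [::] -> t <> [::] -> starts P t <-> ends P s.
Proof.
case/lastP: s => // s e; case: t => // f t + _ _.
by rewrite walk_glue ends_rcons => /and3P[_ /eqP -> _].
Qed.

Lemma walk_glue_at s t x : walk s -> walk t -> ends (eq x) s -> starts (eq x) t -> walk (s ++ t).
Proof.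
case/lastP: s => // s e; case: t => // f t we wt.
by rewrite ends_rcons walk_glue we wt /= => <- <-; rewrite eqxx.
Qed.

Lemma walk_belast_tgt e s :
  walk (e :: s) -> [seq tgt G f | f <- belast e s] = [seq src G f | f <- s].
Proof. by elim: s e => //= f s IH e /andP[/eqP -> /IH ->]. Qed.

Lemma distributing_not_collecting x : distributing G x -> collecting G x -> False.
Proof.
move=> [[e [_ h]] _] [[e1 [e2 [ne [t1 t2]]]] _].
by apply: ne; rewrite (h _ t1) (h _ t2).
Qed.

Lemma distributing_in_inj e f : distributing G (tgt G f) -> tgt G e = tgt G f -> e = f.
Proof. by move=> [[g [_ h]] _] te; rewrite (h e te) (h f). Qed.

Lemma collecting_out_inj e f : collecting G (src G f) -> src G e = src G f -> e = f.
Proof. by move=> [_ [g [_ h]]] se; rewrite (h e se) (h f). Qed.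

(** * Deterministic walks and natural extensions *)

(** Required only at ends of edges, because S' has isolated vertices, which are neither distributing
    nor collecting. *)
Definition fork_or_join : Prop :=
  forall e, (distributing G (src G e) \/ collecting G (src G e)) /\
            (distributing G (tgt G e) \/ collecting G (tgt G e)).

Hypothesis deg : fork_or_join.

Lemma srcN e : ~ distributing G (src G e) -> collecting G (src G e).
Proof. by case: (deg e) => -[]. Qed.
Lemma tgtN e : ~ collecting G (tgt G e) -> distributing G (tgt G e).
Proof. by case: (deg e) => _ []. Qed.

(** Two walks from one edge cannot separate while the continuation is unique. Uniqueness is asked
    only among edges that satisfy [R] (later the good ones) and occur in the two walks, since
    determinism will hold only along particular walks. *)
Lemma walk_prefix (R : pred E) e s t :
  (forall a b c, R a -> R b -> R c -> tgt G a = src G b -> tgt G a = src G c ->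
     b \in s -> c \in t -> b = c) ->
  all R (e :: s) -> all R (e :: t) -> walk (e :: s) -> walk (e :: t) ->
  size s <= size t -> exists r, t = s ++ r.
Proof.
elim: s e t => [|f s IH] e t det; first by exists t.
case: t det => // g t det /= /and3P[Re Rf Rs] /and3P[_ Rg Rt] /andP[/eqP ef ws] /andP[/eqP eg wt] le.
have fg : f = g by apply: (det e); rewrite ?inE ?eqxx.
rewrite -{}fg in det eg Rg wt *; case: (IH f t) => [a b c Ra Rb Rc ab ac bs ct|||||| r ->] //=; rewrite ?Rf //.
  by apply: (det a) => //; rewrite inE ?bs ?ct orbT.
by exists r.
Qed.

Lemma walk_suffix (R : pred E) e s t :
  (forall a b c, R a -> R b -> R c -> tgt G b = src G a -> tgt G c = src G a ->
     b \in s -> c \in t -> b = c) ->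
  all R (rcons s e) -> all R (rcons t e) -> walk (rcons s e) -> walk (rcons t e) ->
  size s <= size t -> exists r, t = r ++ s.
Proof.
elim/last_ind: s e t => [|s f IH] e t det; first by exists t; rewrite cats0.
case/lastP: t det => [|t g] det; rewrite ?size_rcons // !all_rcons !walk_rcons2.
move=> /and3P[Re Rf Rs] /and3P[_ Rg Rt] /andP[ws /eqP ef] /andP[wt /eqP eg] le.
have fg : f = g by apply: (det e); rewrite ?mem_rcons ?inE ?eqxx.
rewrite -{}fg in det eg Rg wt *; case: (IH f t) => [a b c Ra Rb Rc ab ac bs ct|||||| r ->] //=.
- by apply: (det a) => //; rewrite mem_rcons inE ?bs ?ct orbT.
- by rewrite all_rcons Rf.
- by rewrite all_rcons Rf.
by exists r; rewrite rcons_cat.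
Qed.

(** The edges of [s] start at collecting vertices, hence are the only continuations. A shorter path
    from [e] to a distributing vertex would be a proper prefix, and the edge following it would
    start at a distributing vertex. *)
Lemma natRext_first e s : walk (e :: s) -> ends (distributing G) (e :: s) ->
  all (fun f => ~~ pb (distributing G (src G f))) s -> natRext G e (e :: s).
Proof.
move=> w en nd; exists s; split=> // t; rewrite is_pathE /= => wt dt.
rewrite leqNgt; apply/negP => lt.
have [|r er] := walk_prefix (R := predT) (e := e) (s := t) (t := s) _ (all_predT _) (all_predT _) wt w (ltnW lt).
  move=> a b c _ _ _ ab ac _ cs; apply: collecting_out_inj; last by rewrite -ab -ac.
  by apply: srcN => dc; have /pbP := allP nd c cs; apply.
case: r er => [|f r] er; first by rewrite er cats0 ltnn in lt.
move: w nd; rewrite er -cat_cons lastI walk_glue all_cat => /and3P[_ /eqP h _].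
by move=> /and3P[_ /pbP nf _]; apply: nf; rewrite -h.
Qed.

Lemma natLext_last e s : walk (rcons s e) -> starts (collecting G) (rcons s e) ->
  all (fun f => ~~ pb (collecting G (tgt G f))) s -> natLext G e (rcons s e).
Proof.
have headE t : starts (collecting G) (rcons t e) <-> collecting G (src G (head e t)) by case: t.
have pathE t : is_path G (rcons t e) = walk (rcons t e) by rewrite is_pathE; case: t.
move=> w /headE st nd; exists s; split=> //; first by rewrite pathE.
move=> t; rewrite pathE => wt /headE dt; rewrite leqNgt; apply/negP => lt.
have [|r er] := walk_suffix (R := predT) (e := e) (s := t) (t := s) _ (all_predT _) (all_predT _) wt w (ltnW lt).
  move=> a b c _ _ _ ab ac _ cs; apply: distributing_in_inj; last by rewrite ab ac.
  by apply: tgtN => dc; have /pbP := allP nd c cs; apply.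
case/lastP: r er => [|r f] er; first by rewrite er ltnn in lt.
move: w nd dt; rewrite er rcons_cat all_cat all_rcons.
case: (rcons t e) => // g t'; rewrite walk_glue => /and3P[_ /eqP h _].
by move=> /andP[/andP[/pbP nf _] _] dg; apply: nf; rewrite h.
Qed.

(** By minimality: cutting before an edge that starts at a distributing vertex would give a shorter
    extension. *)
Lemma natRext_transient e s : natRext G e (e :: s) ->
  all (fun f => ~~ pb (distributing G (src G f))) s.
Proof.
move=> [t [[<-] + _ minn]]; rewrite is_pathE => /andP[_ w]; apply/allP => f /splitPr es.
case: es w minn => s1 s2 w minn; apply/pbP => d.
have e1 : e :: s1 ++ f :: s2 = rcons (belast e s1) (last e s1) ++ f :: s2 by rewrite -lastI.
move: w; rewrite e1 walk_glue -lastI => /and3P[w1 /eqP h _].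
by have := minn s1; rewrite is_pathE w1 /= h => /(_ isT d); rewrite size_cat /=; lia.
Qed.

Lemma natLext_transient e s : natLext G e (rcons s e) ->
  all (fun f => ~~ pb (collecting G (tgt G f))) s.
Proof.
move=> [t [/rcons_inj[<-] + _ minn]]; rewrite is_pathE => /andP[_ w]; apply/allP => f /splitPr es.
case: es w minn => s1 s2 w minn; apply/pbP => d.
have := minn s2; rewrite is_pathE; move: w; rewrite -cat_rcons rcons_cat.
case: s2 minn => [|g s2] minn; rewrite ?rcons_cons walk_glue => /and3P[_ /eqP h ->] /=;
  rewrite -h => /(_ isT d); rewrite size_cat ?size_rcons /=; lia.
Qed.

Lemma walk_overlap s e t : walk (rcons s e) -> walk (e :: t) -> walk (rcons s e ++ t).
Proof. by case: t => [|f t] w; rewrite ?cats0 // walk_glue w. Qed.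
End Walks.

(** * Counting in finite graphs; existence of natural extensions *)

Section FiniteGraph.
Variables (V E : eqType) (G : graph V E).

(** The injection [f] gives at most as many edges as vertices, which leaves no room for a collision
    under the surjection [g]. *)
Lemma injective_of_surjective (f g : E -> V) : finite_type V -> finite_type E ->
  injective f -> (forall x, exists e, g e = x) -> injective g.
Proof.
move=> [vs hv] [es he] injf surjg.
have u : uniq (map g (undup es)).
  apply: (@leq_size_uniq _ (undup vs)); rewrite ?undup_uniq //.
    move=> x _; have [e <-] := surjg x; apply: map_f; by rewrite mem_undup.
  rewrite size_map -(size_map f) uniq_leq_size // ?map_inj_uniq ?undup_uniq //.
  by move=> x _; rewrite mem_undup.
move=> e1 e2 e12; have h e : index e (undup es) < size (undup es) by rewrite index_mem mem_undup.
rewrite -(nth_index e1 (_ : e1 \in undup es)) ?mem_undup //.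
rewrite -[RHS](nth_index e1 (_ : e2 \in undup es)) ?mem_undup //; congr nth.
apply/eqP; rewrite -(nth_uniq (g e1) _ _ u) ?size_map //.
by rewrite !(nth_map e1) // !nth_index ?mem_undup // e12.
Qed.

Hypotheses (finV : finite_type V) (finE : finite_type E).
Hypothesis deg : forall x, distributing G x \/ collecting G x.

(** If all vertices were distributing, targets would be injective and sources surjective on edges;
    by counting, sources would be injective too, against out-degree greater than one. *)
Lemma exists_collecting (x0 : V) : exists x, collecting G x.
Proof.
have [[x h]|nc] := ClassicalEpsilon.excluded_middle_informative (exists x, collecting G x); first by exists x.
have d x : distributing G x by case: (deg x) => // c; case: nc; exists x.
have inj : injective (src G).
  apply: (@injective_of_surjective (tgt G)) => //.
    by move=> e f; apply: distributing_in_inj.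
  by move=> x; have [_ [e [_ [_ [h _]]]]] := d x; exists e.
by have [_ [e [f [n [he hf]]]]] := d x0; case: n; apply: inj; rewrite he hf.
Qed.

Lemma exists_distributing (x0 : V) : exists x, distributing G x.
Proof.
have [[x h]|nc] := ClassicalEpsilon.excluded_middle_informative (exists x, distributing G x); first by exists x.
have d x : collecting G x by case: (deg x) => // c; case: nc; exists x.
have inj : injective (tgt G).
  apply: (@injective_of_surjective (src G)) => //.
    by move=> e f; apply: collecting_out_inj.
  by move=> x; have [[e [_ [_ [h _]]]] _] := d x; exists e.
by have [[e [f [n [he hf]]]] _] := d x0; case: n; apply: inj; rewrite he hf.
Qed.

Hypothesis conn : strongly_connected G.

Lemma natRext_exists e : exists s, natRext G e s.
Proof.
have [x dx] := exists_distributing (tgt G e).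
pose P n := pb (exists t, [/\ size t = n, is_path G (e :: t) & distributing G (tgt G (last e t))]).
have exP : exists n, P n.
  case: (conn (tgt G e) x) => [h | [[|f t] // [w sf lt]]].
    by exists 0; apply/pbP; exists [::]; rewrite /= h.
  by exists (size (f :: t)); apply/pbP; exists (f :: t); rewrite /= sf eqxx lt.
case: (ex_minnP exP) => n /pbP[t [sz w d]] minn.
by exists (e :: t), t; split=> // t' w' d'; rewrite sz; apply: minn; apply/pbP; exists t'.
Qed.

Lemma natLext_exists e : exists s, natLext G e s.
Proof.
have [x dx] := exists_collecting (src G e).
pose P n := pb (exists t, [/\ size t = n, is_path G (rcons t e) & collecting G (src G (head e t))]).
have exP : exists n, P n.
  case: (conn x (src G e)) => [h | [[|f t] // [w sf lt]]].
    by exists 0; apply/pbP; exists [::]; rewrite /= -h.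
  exists (size (f :: t)); apply/pbP; exists (f :: t).
  by rewrite /= rcons_path lt eqxx andbT sf.
case: (ex_minnP exP) => n /pbP[t [sz w d]] minn.
by exists (rcons t e), t; split=> // t' w' d'; rewrite sz; apply: minn; apply/pbP; exists t'.
Qed.
End FiniteGraph.

(** * Words of concatenated paths and of symmetric subpaths *)

Section Words.
Variables (A V E : eqType) (S : gwords A V E).
Let G := gr S.
Implicit Types (s t : seq E) (e f : E).

Definition forks e : bool := pb (distributing G (src G e)).
Definition joins e : bool := pb (collecting G (tgt G e)).
(** The contribution of [s] to F when other edges precede it: its first edge counts only if it
    leaves a distributing vertex. Dually, [bl] is the contribution to B when other edges follow. *)
Definition fl s : seq A := flatten [seq front S f | f <- s & forks f].
Definition bl s : seq A := flatten [seq back S f | f <- s & joins f].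

Lemma fl_cat s t : fl (s ++ t) = fl s ++ fl t.
Proof. by rewrite /fl filter_cat map_cat flatten_cat. Qed.
Lemma bl_cat s t : bl (s ++ t) = bl s ++ bl t.
Proof. by rewrite /bl filter_cat map_cat flatten_cat. Qed.

Lemma fl_cons e s : fl (e :: s) = (if forks e then front S e else [::]) ++ fl s.
Proof. by rewrite /fl /=; case: ifP. Qed.
Lemma bl_cons e s : bl (e :: s) = (if joins e then back S e else [::]) ++ bl s.
Proof. by rewrite /bl /=; case: ifP. Qed.

Lemma Fw_cons e s : Fw S (e :: s) = front S e ++ fl s.
Proof. by []. Qed.

Lemma Bw_rcons s e : Bw S (rcons s e) = bl s ++ back S e.
Proof. by case: s => // f s; rewrite rcons_cons /Bw belast_rcons last_rcons. Qed.

Lemma Fw_cat s t : s <> [::] -> Fw S (s ++ t) = Fw S s ++ fl t.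
Proof. by case: s => // e s _; rewrite cat_cons !Fw_cons fl_cat catA. Qed.

Lemma Bw_cat s t : t <> [::] -> Bw S (s ++ t) = bl s ++ Bw S t.
Proof. by case/lastP: t => // t e _; rewrite -rcons_cat !Bw_rcons bl_cat catA. Qed.

Lemma fl_forks e s : forks e -> fl (e :: s) = Fw S (e :: s).
Proof. by rewrite fl_cons Fw_cons => ->. Qed.
Lemma bl_joins s e : joins e -> bl (rcons s e) = Bw S (rcons s e).
Proof. by rewrite -cats1 bl_cat bl_cons cats1 Bw_rcons => ->; rewrite cats0. Qed.

Lemma fl_nil s : all (predC forks) s -> fl s = [::].
Proof. by rewrite /fl all_predC has_filter negbK => /eqP ->. Qed.
Lemma bl_nil s : all (predC joins) s -> bl s = [::].
Proof. by rewrite /bl all_predC has_filter negbK => /eqP ->. Qed.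

Lemma size_fl_Fw s : size (fl s) <= size (Fw S s).
Proof.
by case: s => // e s; rewrite fl_cons Fw_cons !size_cat leq_add2r; case: ifP.
Qed.

Hypothesis F_eq_B : forall s, symmetric G s -> Fw S s = Bw S s.

(** The path [s1 ++ t] is symmetric as well, so its F equals its B, which ends in the B of [t], that
    is, in the F of [t]. *)
Lemma Fw_sub s1 t s2 : symmetric G (s1 ++ t ++ s2) -> symmetric G t ->
  Fw S (s1 ++ t ++ s2) = bl s1 ++ Fw S t ++ fl s2.
Proof.
move=> sym symt; have nt := symmetric_neq0 symt.
have sym1 : symmetric G (s1 ++ t).
  move: sym symt; rewrite !symmetricE catA => -[/walk_cat[w _] st _] [_ stt en]; split => //.
    by move: st; rewrite starts_cat // => /(congr1 size); rewrite size_cat;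
       case: (t) nt => //= *; lia.
  by rewrite ends_cat.
rewrite catA Fw_cat; last by case: (s1) nt => //.
by rewrite (F_eq_B sym1) Bw_cat // -(F_eq_B symt) catA.
Qed.

(** * Trimming symmetric paths *)

Variable M : nat.
Hypothesis front_le : forall e, size (front S e) <= M.
Hypothesis back_le : forall e, size (back S e) <= M.

Lemma size_fl s : size (fl s) <= size s * M.
Proof.
elim: s => //= e s IH; rewrite fl_cons size_cat mulSn leq_add //.
by case: ifP => // _; apply: front_le.
Qed.

(** The shortest prefix whose contribution to B comes within [M] of the length of [a] is, if
    nonempty, closed by an edge that contributes letters. This edge ends at a collecting vertex, so
    the rest is symmetric; and it does not overshoot [a], since one edge contributes at most [M]
    letters. *)
Lemma trim_left s a b : symmetric G s -> Fw S s = a ++ b ->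
  exists s0 t, [/\ s = s0 ++ t, symmetric G t, size (bl s0) <= size a &
    size a <= size (bl s0) + M].
Proof.
move=> sym Fs; have [w st en] := (symmetricE _ _).1 sym.
pose P n := size a <= size (bl (take n s)) + M.
have Bs : size (Bw S s) = size a + size b by rewrite -F_eq_B // Fs size_cat.
have exP : exists n, P n.
  exists (size s); rewrite /P take_size; case/lastP: s {P} sym Fs w st en Bs => // s e _ _ _ _ _.
  rewrite Bw_rcons -cats1 bl_cat !size_cat; have := back_le e; lia.
case: (ex_minnP exP) => -[|n] Pn minn.
  by exists [::], s; split=> //; move: Pn; rewrite /P take0.
have nPn : ~~ P n by apply/negP => /minn; rewrite ltnn.
have ltn : n < size s.
  rewrite ltnNge; apply/negP => le; move: Pn nPn; rewrite /P !take_oversize //; lia.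
have [e0 [s' es']] : exists e0 s', s = e0 :: s' by case: (s) ltn => // e0 s'; exists e0, s'.
have eT := take_nth e0 ltn; set e := nth e0 s n in eT.
move: Pn nPn; rewrite /P eT -cats1 bl_cat size_cat bl_cons cats0 => Pn nPn.
have je : joins e by move: Pn nPn; case: ifP => //= _; lia.
rewrite je in Pn nPn; have := back_le e => Le.
have es : s = rcons (take n s) e ++ drop n.+1 s by rewrite -eT cat_take_drop.
have nd : drop n.+1 s <> [::].
  move=> d0; move: Bs; rewrite es d0 cats0 Bw_rcons size_cat; lia.
exists (rcons (take n s) e), (drop n.+1 s); split=> //.
- rewrite es in w en; apply/symmetricE; split.
  + by case: (walk_cat w).
  + apply/(walk_join _ w) => //; first by case: (take n s).
    by rewrite ends_rcons; apply/pbP.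
  + by rewrite ends_cat in en.
- by rewrite -cats1 bl_cat size_cat bl_cons cats0 je; lia.
by rewrite -cats1 bl_cat size_cat bl_cons cats0 je; lia.
Qed.

(** Dual to [trim_left]: the shortest tail that comes within [M] of the length of [a], if nonempty,
    begins with an edge leaving a distributing vertex, where the kept part ends. *)
Lemma trim_right s a b : symmetric G s -> Fw S s = b ++ a ->
  exists t s0, [/\ s = t ++ s0, symmetric G t, size (fl s0) <= size a &
    size a <= size (fl s0) + M].
Proof.
move=> sym Fs; have [w st en] := (symmetricE _ _).1 sym.
pose P n := (n <= size s) && (size a <= size (fl (drop n s)) + M).
have sF : size (Fw S s) = size b + size a by rewrite Fs size_cat.
have exP : exists n, P n.
  exists 0; rewrite /P drop0; case: s {P} sym Fs w st en sF => // e s _ _ _ _ _.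
  rewrite Fw_cons fl_cons !size_cat; have := front_le e; lia.
have bP : forall n, P n -> n <= size s by move=> n /andP[].
case: (ex_maxnP exP bP) => n /andP[len Pn] maxn.
have [ltn | le] := ltnP n (size s); last first.
  by exists s, [::]; rewrite cats0; split=> //; move: Pn; rewrite drop_oversize.
have nP1 : size (fl (drop n.+1 s)) + M < size a.
  by rewrite ltnNge; apply/negP => h; have := maxn n.+1; rewrite /P ltn h ltnn => /(_ isT).
have [e0 [s' es']] : exists e0 s', s = e0 :: s' by case: (s) ltn => // e0 s'; exists e0, s'.
have eD := drop_nth e0 ltn; set e := nth e0 s n in eD.
move: Pn; rewrite eD fl_cons size_cat => Pn.
have je : forks e by move: Pn; case: ifP => //= _; lia.
rewrite je in Pn; have := front_le e => Le.
have es : s = take n s ++ e :: drop n.+1 s by rewrite -eD cat_take_drop.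
have nt : take n s <> [::].
  move=> d0; move: sF; rewrite es d0 Fw_cons size_cat; lia.
exists (take n s), (e :: drop n.+1 s); split=> //.
- rewrite es in w st; apply/symmetricE; split.
  + by case: (walk_cat w).
  + by rewrite starts_cat in st.
  + by apply/(walk_join _ w) => //; apply/pbP.
- by rewrite fl_cons je size_cat; lia.
by rewrite fl_cons je size_cat; lia.
Qed.
End Words.

(** * Symmetric paths cut out around an edge *)

Section Cores.
Variables (A V E : eqType) (S : gwords A V E).
Let G := gr S.
Implicit Types (s t : seq E) (e f : E).

Lemma fl_belast e s : walk G (e :: s) ->
  all (fun f => ~~ pb (distributing G (tgt G f))) (belast e s) -> fl S s = [::].
Proof.
move=> w h; apply: fl_nil; have := walk_belast_tgt w => eq.
have : all (fun x => ~~ pb (distributing G x)) [seq tgt G f | f <- belast e s] by rewrite all_map.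
by rewrite eq all_map.
Qed.

Lemma bl_belast e s : walk G (e :: s) ->
  all (fun f => ~~ pb (collecting G (src G f))) s -> bl S (belast e s) = [::].
Proof.
move=> w h; apply: bl_nil; have := walk_belast_tgt w => eq.
have : all (fun x => ~~ pb (collecting G x)) [seq src G f | f <- s] by rewrite all_map.
by rewrite -eq all_map.
Qed.

(** Cutting at the last edge that starts at a collecting vertex leaves no collecting vertex in the
    interior, so the B of the remaining path is just the back word of [e]. *)
Lemma left_core s e : walk G (rcons s e) -> starts G (collecting G) (rcons s e) ->
  exists s0 l, [/\ s = s0 ++ l, starts G (collecting G) (rcons l e) & bl S l = [::]].
Proof.
move=> w st.
have : has (fun f => pb (collecting G (src G f))) (rcons s e).
  by case: (rcons s e) st => //= f t /pbP ->.
case/split_last => s0 [f [l [es Cf Nl]]].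
exists s0, (belast f l); have e1 : rcons (belast f l) e = f :: l.
  have := congr1 (last e) es; rewrite last_rcons last_cat /= => ->.
  by rewrite -lastI.
split.
- by apply: (@rcons_injl _ e); rewrite es rcons_cat e1.
- by rewrite e1 /=; apply/pbP.
by apply: bl_belast Nl; move: w; rewrite es => /walk_cat[].
Qed.

(** Cutting at the first edge that ends at a distributing vertex makes the F of the remaining path
    just the front word of [e]. *)
Lemma right_core e s : walk G (e :: s) -> ends G (distributing G) (e :: s) ->
  exists r s0, [/\ s = r ++ s0, ends G (distributing G) (e :: r) & fl S r = [::]].
Proof.
move=> w en.
have : has (fun f => pb (distributing G (tgt G f))) (e :: s).
  move: en; rewrite lastI ends_rcons => /pbP h; apply/hasP; exists (last e s) => //.
  by rewrite mem_rcons inE eqxx.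
case/split_first => l [f [s0 [es Df Nl]]].
have {es} [r [er es]] : exists r, e :: r = rcons l f /\ s = r ++ s0.
  case: l {Nl} es => [|g l] [-> ->]; first by exists [::].
  by exists (rcons l f); rewrite cat_rcons.
exists r, s0; split=> //; first by rewrite er ends_rcons; apply/pbP.
apply: (@fl_belast e); first by move: w; rewrite es -cat_cons => /walk_cat[].
by move: er; rewrite lastI => /rcons_inj[-> _].
Qed.
End Cores.

(** * Symmetric paths whose words are factors of W *)

Section Admissible.
Variables (A V : eqType) (E : finType) (S : gwords A V E) (W : nat -> A).
Let G := gr S.
Hypothesis rec : recurrent W.
Hypothesis F_eq_B : forall s, symmetric G s -> Fw S s = Bw S s.
Hypothesis covered : forall u, factorW u W -> exists s, symmetric G s /\ infix u (Fw S s).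

Definition word_bound := \max_(e : E) (size (front S e) + size (back S e)).

Lemma front_bound e : size (front S e) <= word_bound.
Proof. exact: leq_trans (leq_addr _ _) (leq_bigmax (F := fun e => size (front S e) + size (back S e)) e). Qed.
Lemma back_bound e : size (back S e) <= word_bound.
Proof. exact: leq_trans (leq_addl _ _) (leq_bigmax (F := fun e => size (front S e) + size (back S e)) e). Qed.

(* Long words between and around u1 and u2 leave room to trim the symmetric
   path to one whose word is itself a factor of W. *)
Lemma admissible_path u1 u2 n : factorW u1 W -> factorW u2 W ->
  exists t1 m t2, [/\ symmetric G (t1 ++ m ++ t2), factorW (Fw S (t1 ++ m ++ t2)) W,
    symmetric G t1 /\ infix u1 (Fw S t1), symmetric G t2 /\ infix u2 (Fw S t2) & n <= size m].
Proof.
pose M := word_bound; move=> fu1 fu2.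
(* The first occurrence leaves room for [M] letters on its left. A gap of more than [(n + 2) * M]
   letters before the second one suffices: the two inner trimmings can each leave up to [M] of its
   letters, and [n] edges emit at most [n * M]. *)
have [i [lei eu1]] := rec fu1 M.
have [j [lej eu2]] := rec fu2 (i + size u1 + (n + 3) * M + 1).
pose g := subw W (i + size u1) (j - (i + size u1)).
pose l := subw W (i - M) M; pose r := subw W (j + size u2) M.
have eqw : subw W (i - M) (M + (size u1 + ((j - (i + size u1)) + (size u2 + M)))) =
    l ++ u1 ++ g ++ u2 ++ r.
  rewrite !subw_cat subnK // eu1; congr (_ ++ (_ ++ (_ ++ _))).
  by rewrite subnKC ?eu2 //; lia.
have [s [sym /infixP[a [b Fs]]]] := covered (factor_subw W (i - M)
  (M + (size u1 + ((j - (i + size u1)) + (size u2 + M))))).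
rewrite eqw in Fs.
have [sl sr sg] : [/\ size l = M, size r = M & size g = j - (i + size u1)] by rewrite !size_subw.
have Fs1 : Fw S s = (a ++ l) ++ (u1 ++ g ++ u2 ++ r ++ b) by rewrite Fs !catA.
(* Since [l] has length [M], trimming [a ++ l] to at most [M] letters removes all of the
   uncontrolled [a]; the right end is treated likewise with [r]. *)
have [s0 [s' [es syms' le1 le2]]] := trim_left F_eq_B back_bound sym Fs1.
have [l' [el Fs']] : exists l', l = take (M - size l') l ++ l' /\ Fw S s' = l' ++ u1 ++ g ++ u2 ++ r ++ b.
  have : Fw S s = bl S s0 ++ Fw S s'.
    have := @Fw_sub _ _ _ S F_eq_B s0 s' [::]; rewrite cats0 => h.
    by rewrite es h -?es // /fl /= cats0.
  rewrite Fs1 => /esym /cat_inj_size h; have {h} [//|q [eq1 eq2]] := h.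
  have szq : size q <= M by move: (congr1 size eq1) le2; rewrite !size_cat -/M; lia.
  exists q; split=> //.
  have : drop (size a + (M - size q)) (a ++ l) = q.
    have -> : size a + (M - size q) = size (bl S s0).
      by have := congr1 size eq1; rewrite !size_cat sl; lia.
    by rewrite eq1 drop_size_cat.
  rewrite drop_cat ltnNge leq_addr /= addKn => e; rewrite -{1}[l](cat_take_drop (M - size q)).
  by rewrite e.
have Fs2 : Fw S s' = (l' ++ u1 ++ g ++ u2) ++ r ++ b by rewrite Fs' -!catA.
have [s2 [s3 [es2 syms2 le3 le4]]] := trim_right front_bound syms' Fs2.
have [r' [er Fs'']] : exists r', r = r' ++ drop (size r') r /\ Fw S s2 = l' ++ u1 ++ g ++ u2 ++ r'.
  have eF : Fw S s' = Fw S s2 ++ fl S s3 by rewrite es2 Fw_cat //; apply: symmetric_neq0 syms2.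
  have hs : size (l' ++ u1 ++ g ++ u2) <= size (Fw S s2).
    by have := congr1 size Fs2; rewrite eF !size_cat; rewrite !size_cat in le3; lia.
  have [q [eq1 eq2]] := cat_inj_size (etrans (esym Fs2) eF) hs.
  have szq : size q <= size r by move: (congr1 size eq2); rewrite !size_cat in le3 le4 *;
    rewrite sr -/M; lia.
  exists q; split; last by rewrite eq1 -!catA.
  by rewrite -{1}[r](cat_take_drop (size q)) -(takel_cat b szq) eq2 take_size_cat.
have fac : factorW (Fw S s2) W.
  apply: (@factorW_infix _ _ _ (l ++ u1 ++ g ++ u2 ++ r)); last first.
    by rewrite -eqw; apply: factor_subw.
  apply/infixP; exists (take (M - size l') l), (drop (size r') r).
  by rewrite {1}el {1}er Fs'' -!catA.
have Fs3 : Fw S s2 = (l' ++ u1) ++ (g ++ u2 ++ r') by rewrite Fs'' -!catA.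
have [t1 [q1 [e1 symt1 le5 le6]]] := trim_right front_bound syms2 Fs3.
have Fs4 : Fw S s2 = (l' ++ u1 ++ g) ++ (u2 ++ r') by rewrite Fs'' -!catA.
have [q2 [t2 [e2 symt2 le7 le8]]] := trim_left F_eq_B back_bound syms2 Fs4.
have F1 : Fw S s2 = Fw S t1 ++ fl S q1 by rewrite e1 Fw_cat //; apply: symmetric_neq0 symt1.
have F2 : Fw S s2 = bl S q2 ++ Fw S t2.
  have := @Fw_sub _ _ _ S F_eq_B q2 t2 [::]; rewrite cats0 => h.
  by rewrite e2 h -?e2 // /fl /= cats0.
have inf1 : infix u1 (Fw S t1).
  have hs : size (l' ++ u1) <= size (Fw S t1).
    by have := congr1 size Fs3; rewrite F1 !size_cat; rewrite !size_cat in le5; lia.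
  have [q [-> _]] := cat_inj_size (etrans (esym Fs3) F1) hs.
  by rewrite -catA infix_mid.
have inf2 : infix u2 (Fw S t2).
  have [q [_ ->]] := cat_inj_size (etrans (esym F2) Fs4) le7.
  by rewrite infix_mid.
(* Otherwise all but the first [n] edges of [q1] lie in [t2], and comparing lengths makes the gap
   [g] too short. *)
have ltq : size t2 + n <= size q1.
  rewrite leqNgt; apply/negP => lt.
  have le : size (fl S q1) <= n * M + size (Fw S t2).
    rewrite -{1}(cat_take_drop n q1) fl_cat size_cat leq_add //.
      apply: leq_trans (size_fl front_bound _) _.
      by rewrite leq_mul2r size_take_min geq_minl orbT.
    have e12 : q2 ++ t2 = (t1 ++ take n q1) ++ drop n q1 by rewrite -catA cat_take_drop -e1.
    have [|p [_ ->]] := cat_inj_size e12.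
      by have := congr1 size e12; rewrite !size_cat size_drop; lia.
    case: p => [|x p]; first exact: size_fl_Fw.
    by rewrite Fw_cat // size_cat leq_addl.
  have sz := congr1 size F2; move: sz le6 le8; rewrite Fs'' !size_cat -/M sg; lia.
have [|m [em eq1]] := cat_inj_size (etrans (esym e1) e2).
  by have := congr1 size (etrans (esym e1) e2); rewrite !size_cat; lia.
exists t1, m, t2; rewrite catA -em -e2; split=> //.
by move: ltq; rewrite eq1 size_cat; lia.
Qed.
End Admissible.

(** * The graph S' *)

Section Split.
Variables (A : eqType) (V E : finType) (S : gwords A V E) (W : nat -> A) (v : E).
Let G := gr S.
Let G1 := S1graph S v.
Let S' := S1 S v.
Hypothesis scheme : rauzy_scheme S W.
Hypothesis supp : support_edge G v.

Implicit Types (e x y : E) (a b : E1 S v) (s t : seq (E1 S v)).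

Let srcvC : collecting G (src G v). Proof. by case: supp. Qed.
Let tgtvD : distributing G (tgt G v). Proof. by case: supp. Qed.

Lemma src_support e : src G e = src G v -> e = v.
Proof. exact: collecting_out_inj. Qed.
Lemma tgt_support e : tgt G e = tgt G v -> e = v.
Proof. exact: distributing_in_inj. Qed.
Lemma support_noloop : src G v <> tgt G v.
Proof. by move=> h; apply: (distributing_not_collecting tgtvD); rewrite -h. Qed.
Lemma entering_neq e : tgt G e = src G v -> e != v.
Proof. by move=> h; apply/eqP => ev; apply: support_noloop; rewrite -h ev. Qed.
Lemma leaving_neq e : src G e = tgt G v -> e != v.
Proof. by move=> h; apply/eqP => ev; apply: support_noloop; rewrite -h ev. Qed.

Lemma cross_proof x y : tgt G x = src G v -> src G y = tgt G v ->
  (tgt G (x, y).1 == src G v) && (src G (x, y).2 == tgt G v).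
Proof. by move=> /= -> ->; rewrite !eqxx. Qed.

Definition old_edge e (h : e != v) : E1 S v := inl (exist _ e h).
Definition cross x y (hx : tgt G x = src G v) (hy : src G y = tgt G v) : E1 S v :=
  inr (exist _ (x, y) (cross_proof hx hy)).

Definition proj a : E := match a with inl e => val e | inr _ => v end.
Definition projV (z : V1 V E) : V :=
  match z with inl x => x | inr (inl _) => src G v | inr (inr _) => tgt G v end.

Lemma src_proj a : src G (proj a) = projV (src G1 a).
Proof. by case: a => [e|p] //=; case: eqP. Qed.
Lemma tgt_proj a : tgt G (proj a) = projV (tgt G1 a).
Proof. by case: a => [e|p] //=; case: eqP. Qed.

Lemma old_edge_val (e : {e : E | e != v}) : inl e = old_edge (valP e).
Proof. by congr inl; apply: val_inj. Qed.

Lemma cross_val (p : {p : E * E | (tgt G p.1 == src G v) && (src G p.2 == tgt G v)}) :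
  exists x y (hx : tgt G x = src G v) (hy : src G y = tgt G v), inr p = cross hx hy.
Proof.
case: p => [[x y] h]; have /andP[/eqP hx /eqP hy] := h; exists x, y, hx, hy.
by congr inr; apply: val_inj.
Qed.

(** A cross edge is entered only from its own [x_i] and left only by its own [y_j], so its indices
    can be read off its neighbours. *)
Lemma adjP a b : tgt G1 a = src G1 b ->
  match a, b with
  | inl e, inl f => [/\ tgt G (val e) = src G (val f), tgt G (val e) != src G v &
                     src G (val f) != tgt G v]
  | inl e, inr p => val e = (val p).1
  | inr p, inl f => (val p).2 = val f
  | inr _, inr _ => False
  end.
Proof.
case: a b => [e|p] [f|q] //=; do ?case: eqP => //.
- by move=> _ _ [].
- by move=> _ [].
by move=> _ [].
Qed.

(** * Degrees of the vertices of S' *)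

Lemma src1_inl a (x : V) : src G1 a = inl x -> exists e' : {e : E | e != v},
  [/\ a = inl e', src G (val e') = x & x <> tgt G v].
Proof. by case: a => [e|p] //=; case: eqP => // ne [<-]; exists e. Qed.
Lemma tgt1_inl a (x : V) : tgt G1 a = inl x -> exists e' : {e : E | e != v},
  [/\ a = inl e', tgt G (val e') = x & x <> src G v].
Proof. by case: a => [e|p] //=; case: eqP => // ne [<-]; exists e. Qed.

Lemma src1_old e h : src G e <> tgt G v -> src G1 (@old_edge e h) = inl (src G e).
Proof. by move=> /eqP /negbTE /= ->. Qed.
Lemma tgt1_old e h : tgt G e <> src G v -> tgt G1 (@old_edge e h) = inl (tgt G e).
Proof. by move=> /eqP /negbTE /= ->. Qed.

Section OldVertex.
Variable x : V.
Hypotheses (xs : x <> src G v) (xt : x <> tgt G v).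

Lemma in_one_old : in_one G x -> in_one G1 (inl x).
Proof.
move=> [e [te ue]]; have ne : e != v by apply/eqP => ev; case: xt; rewrite -te ev.
exists (old_edge ne); rewrite tgt1_old te //; split=> // e' /tgt1_inl[f [-> tf _]].
by congr inl; apply: val_inj; apply: ue.
Qed.
Lemma out_one_old : out_one G x -> out_one G1 (inl x).
Proof.
move=> [e [te ue]]; have ne : e != v by apply/eqP => ev; case: xs; rewrite -te ev.
exists (old_edge ne); rewrite src1_old te //; split=> // e' /src1_inl[f [-> tf _]].
by congr inl; apply: val_inj; apply: ue.
Qed.
Lemma in_many_old : in_many G x -> in_many G1 (inl x).
Proof.
move=> [e [f [nef [te tf]]]].
have ne : e != v by apply/eqP => ev; case: xt; rewrite -te ev.
have nf : f != v by apply/eqP => ev; case: xt; rewrite -tf ev.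
by exists (old_edge ne), (old_edge nf); rewrite !tgt1_old ?te ?tf //; split=> // -[].
Qed.
Lemma out_many_old : out_many G x -> out_many G1 (inl x).
Proof.
move=> [e [f [nef [te tf]]]].
have ne : e != v by apply/eqP => ev; case: xs; rewrite -te ev.
have nf : f != v by apply/eqP => ev; case: xs; rewrite -tf ev.
by exists (old_edge ne), (old_edge nf); rewrite !src1_old ?te ?tf //; split=> // -[].
Qed.
End OldVertex.

(** The vertex [A_i] is entered by [x_i] alone and left by all [v_ij], of which there are several
    because the end of [v] is distributing. *)
Lemma A_distributing x : tgt G x = src G v -> distributing G1 (inr (inl x)).
Proof.
move=> hx; split.
  exists (old_edge (entering_neq hx)); rewrite /= hx eqxx; split=> // -[e|p] //=.
  by case: eqP => // _ [ex]; congr inl; apply: val_inj.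
have [_ [y1 [y2 [ny [h1 h2]]]]] := tgtvD.
by exists (cross hx h1), (cross hx h2); split=> // -[].
Qed.

Lemma B_collecting y : src G y = tgt G v -> collecting G1 (inr (inr y)).
Proof.
move=> hy; split; last first.
  exists (old_edge (leaving_neq hy)); rewrite /= hy eqxx; split=> // -[e|p] //=.
  by case: eqP => // _ [ex]; congr inl; apply: val_inj.
have [[x1 [x2 [nx [h1 h2]]]] _] := srcvC.
by exists (cross h1 hy), (cross h2 hy); split=> // -[].
Qed.

Lemma distributing_old (x : V) : x <> tgt G v -> distributing G x -> distributing G1 (inl x).
Proof.
move=> xt dx; have xs : x <> src G v.
  by move=> h; apply: (distributing_not_collecting dx); rewrite h.
by case: dx => *; split; [apply: in_one_old | apply: out_many_old].
Qed.
Lemma collecting_old (x : V) : x <> src G v -> collecting G x -> collecting G1 (inl x).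
Proof.
move=> xs cx; have xt : x <> tgt G v.
  by move=> h; apply: (distributing_not_collecting _ cx); rewrite h.
by case: cx => *; split; [apply: in_many_old | apply: out_one_old].
Qed.

Lemma vertex_cases (x : V) : distributing G x \/ collecting G x.
Proof. by case: scheme => -[[]]. Qed.

Lemma old_cases (x : V) : x <> src G v -> x <> tgt G v ->
  distributing G1 (inl x) \/ collecting G1 (inl x).
Proof.
move=> xs xt; case: (vertex_cases x) => h.
  by left; apply: distributing_old.
by right; apply: collecting_old.
Qed.

Lemma fork_or_join1 : fork_or_join G1.
Proof.
case=> [e|p]; last first.
  have [x [y [hx [hy ->]]]] := cross_val p.
  by split; [left; apply: A_distributing | right; apply: B_collecting].
have ne := valP e; split=> /=; case: eqP => h.
- by right; apply: B_collecting.
- by apply: old_cases => // h'; case/eqP: ne; apply: src_support.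
- by left; apply: A_distributing.
by apply: old_cases => // h'; case/eqP: ne; apply: tgt_support.
Qed.

(** * Words of S' under the projection to S *)

(** The branching at the end of [v] moves from the edges [y_j], which now leave collecting vertices,
    to the cross edges; the joining at the start of [v] moves likewise away from the [x_i]. *)
Lemma forks_inl e h : forks S' (@old_edge e h) = forks S e && (src G e != tgt G v).
Proof.
rewrite /forks /=; case: eqP => [h'|ne]; rewrite ?andbF ?andbT.
  by apply/pbP => d; apply: (distributing_not_collecting d); apply: B_collecting.
apply/pbP/pbP => d; last exact: distributing_old.
case: (vertex_cases (src G e)) => // c.
have ns : src G e <> src G v by move=> /src_support ev; rewrite ev eqxx in h.
by case: (distributing_not_collecting d); apply: collecting_old.
Qed.

Lemma joins_inl e h : joins S' (@old_edge e h) = joins S e && (tgt G e != src G v).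
Proof.
rewrite /joins /=; case: eqP => [h'|ne]; rewrite ?andbF ?andbT.
  by apply/pbP => d; apply: (distributing_not_collecting _ d); apply: A_distributing.
apply/pbP/pbP => d; last exact: collecting_old.
case: (vertex_cases (tgt G e)) => // c.
have ns : tgt G e <> tgt G v by move=> /tgt_support ev; rewrite ev eqxx in h.
by case: (distributing_not_collecting _ d); apply: distributing_old.
Qed.

Lemma forks_inr p : forks S' (inr p).
Proof. by apply/pbP; have [x [y [hx [hy ->]]]] := cross_val p; apply: A_distributing. Qed.
Lemma joins_inr p : joins S' (inr p).
Proof. by apply/pbP; have [x [y [hx [hy ->]]]] := cross_val p; apply: B_collecting. Qed.

Lemma forks_support : forks S v = false.
Proof. by apply/pbP => d; apply: (distributing_not_collecting d). Qed.
Lemma joins_support : joins S v = false.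
Proof. by apply/pbP => d; apply: (distributing_not_collecting _ d). Qed.
Lemma forks_leaving y : src G y = tgt G v -> forks S y.
Proof. by rewrite /forks -/G => ->; apply/pbP. Qed.
Lemma joins_entering x : tgt G x = src G v -> joins S x.
Proof. by rewrite /joins -/G => ->; apply/pbP. Qed.

(* S' emits Y_j on v_ij and S only on the next edge y_j; [pre] is the word
   emitted early (and [post] the word X_i emitted late). *)
Definition pre a : seq A := match a with inl _ => [::] | inr p => front S (val p).2 end.
Definition post a : seq A := match a with inl _ => [::] | inr p => back S (val p).1 end.

(** What a cross edge emits early is exactly what the following [y_j] adds in S but not in S', so
    [pre] telescopes along the walk. *)
Lemma fl_proj a s : walk G1 (a :: s) ->
  pre a ++ fl S' s = fl S [seq proj b | b <- s] ++ pre (last a s).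
Proof.
elim: s a => [|b s IH] a; first by rewrite /= /fl /= cats0.
move=> /= /andP[/eqP ab ws]; rewrite !fl_cons -catA -(IH b) // !catA; congr (_ ++ _).
move: a b ab {ws} => [e|p] [f|q] /adjP //=.
- move=> [_ _ h]; rewrite old_edge_val forks_inl h andbT /=.
  by rewrite (negbTE h); case: ifP => _; rewrite cats0.
- by move=> _; rewrite forks_inr forks_support.
move=> pf; have hy : src G (val f) = tgt G v by rewrite -[val f]pf; have /andP[_ /eqP] := valP p.
by rewrite old_edge_val forks_inl hy eqxx andbF forks_leaving // pf !cats0.
Qed.

Lemma bl_proj a s : walk G1 (a :: s) ->
  post a ++ bl S [seq proj b | b <- belast a s] = bl S' (belast a s) ++ post (last a s).
Proof.
elim: s a => [|b s IH] a; first by rewrite /= /bl /= cats0.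
move=> /= /andP[/eqP ab ws]; rewrite !bl_cons -[RHS]catA -(IH b) // !catA; congr (_ ++ _).
move: a b ab {ws} => [e|p] [f|q] /adjP //=.
- move=> [_ h _]; rewrite old_edge_val joins_inl h andbT /=.
  by rewrite (negbTE h); case: ifP => _; rewrite cats0.
- move=> ef; have hx : tgt G (val e) = src G v by rewrite [val e]ef; have /andP[/eqP] := valP q.
  by rewrite old_edge_val joins_inl hx eqxx andbF joins_entering // ef.
by move=> _; rewrite joins_inr joins_support cats0.
Qed.

(** A path starting with some [y_j] or ending with some [x_i] must be completed by [v] to be
    symmetric in S; each boolean [nseq] is this optional copy of [v]. *)
Definition project s : seq E :=
  if s is a :: s' then nseq (src G (proj a) == tgt G v) v ++ [seq proj b | b <- s] ++
                       nseq (tgt G (proj (last a s')) == src G v) v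
  else [::].

(** A cross edge starts at a distributing and ends at a collecting vertex, so it is neither first
    nor last in a symmetric path. *)
Lemma starts_old s : starts G1 (collecting G1) s ->
  exists e (h : e != v) s', s = old_edge h :: s'.
Proof.
case: s => // -[e|p] s /= c; first by exists (val e), (valP e), s; rewrite -old_edge_val.
have [x [y [hx [hy ep]]]] := cross_val p; case: (distributing_not_collecting _ c).
by have /pbP := forks_inr p.
Qed.

Lemma ends_old s : ends G1 (distributing G1) s ->
  exists e (h : e != v) s', s = rcons s' (old_edge h).
Proof.
case/lastP: s => // s a; rewrite ends_rcons; case: a => [e|p] d.
  by exists (val e), (valP e), s; rewrite -old_edge_val.
by case: (distributing_not_collecting d); have /pbP := joins_inr p.
Qed.

Lemma projectE e (he : e != v) f (hf : f != v) s t :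
  old_edge he :: s = rcons t (old_edge hf) ->
  project (old_edge he :: s) = nseq (src G e == tgt G v) v ++
    [seq proj b | b <- old_edge he :: s] ++ nseq (tgt G f == src G v) v.
Proof.
by move=> es; rewrite /project; have := congr1 (last (old_edge he)) es; rewrite last_rcons /= => ->.
Qed.

Lemma walk_proj s : walk G1 s -> walk G [seq proj b | b <- s].
Proof.
case: s => // a s; rewrite /walk /= path_map; apply: sub_path => b c /eqP h.
by rewrite /= /adjacent src_proj tgt_proj h.
Qed.

Lemma walk_nseq (b c : bool) (r : seq E) : walk G r -> (b -> starts G (eq (tgt G v)) r) ->
  (c -> ends G (eq (src G v)) r) -> walk G (nseq b v ++ r ++ nseq c v).
Proof.
move=> w hb hc; have w1 : walk G (r ++ nseq c v).
  case: c hc => [h|_]; last by rewrite cats0.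
  by apply: walk_glue_at (h isT) _; rewrite //= .
case: b hb => // h; apply: (@walk_glue_at _ _ _ [:: v] _ (tgt G v)) => //=.
by rewrite starts_cat; [apply: h | case: (r) (h isT)].
Qed.

Lemma symmetric_project s : symmetric G1 s -> symmetric G (project s).
Proof.
move=> /symmetricE[w st en]; have [e [he [s' es]]] := starts_old st.
have [f [hf [t' et]]] := ends_old en; have ee := etrans (esym es) et.
rewrite es (projectE ee); have wp := walk_proj w; rewrite es in wp.
apply/symmetricE; split.
- apply: walk_nseq => //; first by move=> /eqP.
  by move=> /eqP tf; rewrite ee map_rcons ends_rcons /= tf.
- move: st; rewrite es /=; case: eqP => //= ne c.
  case: (vertex_cases (src G e)) => // d; case: (distributing_not_collecting _ c).
  exact: distributing_old.
rewrite ends_cat // ee map_rcons; move: en; rewrite et ends_rcons /=.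
case: eqP => /= [_|ne] c; first by rewrite cats1 ends_rcons.
rewrite cats0 ends_rcons /=; case: (vertex_cases (tgt G f)) => // d.
by case: (distributing_not_collecting c); apply: collecting_old.
Qed.

(** A leading [v] accounts for the prefix [V] in the front word of [y_j] in S'; a trailing [v] adds
    nothing to F, as it leaves a collecting vertex. *)
Lemma Fw_project s : symmetric G1 s -> Fw S' s = Fw S (project s).
Proof.
move=> /symmetricE[w st en]; have [e [he [s' es]]] := starts_old st.
have [f [hf [t' et]]] := ends_old en; have ee := etrans (esym es) et.
have el : last (old_edge he) s' = old_edge hf.
  by have := congr1 (last (old_edge he)) ee; rewrite last_rcons.
rewrite es (projectE ee) Fw_cons; rewrite es in w; have := fl_proj w.
rewrite el [pre _]/= [pre _]/= cats0 cat0s => ->; have nv : fl S (nseq (tgt G f == src G v) v) = [::].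
  by case: eqP => //= _; rewrite fl_cons forks_support.
have -> : front S' (old_edge he) = (if src G e == tgt G v then Vword S v else [::]) ++ front S e.
  by rewrite /=; case: eqP.
rewrite map_cons cat_cons; case: eqP => h; last by rewrite !cat0s Fw_cons fl_cat nv cats0.
by rewrite -catA (_ : nseq true v = [:: v]) // cat1s Fw_cons fl_cons forks_leaving // fl_cat nv cats0.
Qed.

(** Axiom (3) for the symmetric path consisting of [v] alone. *)
Lemma vword_back : Vword S v = back S v.
Proof.
case: scheme => _ _ h _ _; have := h [:: v]; rewrite /Fw /Bw /= cats0; apply.
by split.
Qed.

Lemma Bw_project s : symmetric G1 s -> Bw S' s = Bw S (project s).
Proof.
move=> /symmetricE[w st en]; have [e [he [s' es]]] := starts_old st.
have [f [hf [t' et]]] := ends_old en; have ee := etrans (esym es) et.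
have el : last (old_edge he) s' = old_edge hf.
  by have := congr1 (last (old_edge he)) ee; rewrite last_rcons.
have eb : belast (old_edge he) s' = t' by apply: (@rcons_injl _ (old_edge hf)); rewrite -ee lastI el.
rewrite es (projectE ee) ee Bw_rcons; rewrite es in w; have := bl_proj w.
rewrite el eb /= cats0 => <-; have nv : bl S (nseq (src G e == tgt G v) v) = [::].
  by case: eqP => //= _; rewrite bl_cons joins_support.
rewrite Bw_cat; last by rewrite map_rcons; case: (map _ _).
rewrite nv /= map_rcons /=; case: eqP => h; last by rewrite cats0 Bw_rcons.
rewrite cats1 Bw_rcons -cats1 bl_cat -catA; congr (_ ++ _).
by rewrite bl_cons joins_entering // cats0 vword_back.
Qed.

Lemma F_eq_B1 s : symmetric G1 s -> Fw S' s = Bw S' s.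
Proof.
move=> sym; rewrite Fw_project // Bw_project //.
by case: scheme => _ _ h _ _; apply/h/symmetric_project.
Qed.

(** * Distinct first and last letters in S' *)

(** A distributing vertex of S' is either an old one, whose outgoing edges keep their words, or some
    [A_i], where the words [Y_j] are those of the edges leaving the end of [v]. *)
Lemma front_distinct1 z a b : distributing G1 z -> a <> b -> src G1 a = z -> src G1 b = z ->
  exists l1 w1 l2 w2, [/\ front S' a = l1 :: w1, front S' b = l2 :: w2 & l1 <> l2].
Proof.
case: scheme => _ [F2 _] _ _ _ d ab sa; subst z; case: a ab d => [e|p] ab d.
  have := d; rewrite -/(forks S' (inl e)) => /pbP; rewrite -/(forks S' (inl e)).
  rewrite old_edge_val forks_inl => /andP[/pbP de ne] /=.
  rewrite (negbTE ne) => /src1_inl[f [eb sf _]]; rewrite eb /= in ab *.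
  rewrite sf (negbTE ne); apply: (F2 (src G (val e))) => //.
  by move=> ef; apply: ab; congr inl; apply: val_inj.
case: b ab => [f|q] ab /=; first by case: eqP.
move=> [ex]; have /andP[_ /eqP hp] := valP p; have /andP[_ /eqP hq] := valP q.
apply: (F2 (tgt G v)) => // ey; apply: ab; congr inr; apply: val_inj.
by rewrite (surjective_pairing (val p)) (surjective_pairing (val q)); congr pair.
Qed.

Lemma back_distinct1 z a b : collecting G1 z -> a <> b -> tgt G1 a = z -> tgt G1 b = z ->
  exists l1 w1 l2 w2, [/\ back S' a = rcons w1 l1, back S' b = rcons w2 l2 & l1 <> l2].
Proof.
case: scheme => _ [_ B2] _ _ _ d ab sa; subst z; case: a ab d => [e|p] ab d.
  have := d; rewrite -/(joins S' (inl e)) => /pbP; rewrite -/(joins S' (inl e)).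
  rewrite old_edge_val joins_inl => /andP[/pbP de ne] /=.
  rewrite (negbTE ne) => /tgt1_inl[f [eb sf _]]; rewrite eb /= in ab *.
  rewrite sf (negbTE ne); apply: (B2 (tgt G (val e))) => //.
  by move=> ef; apply: ab; congr inl; apply: val_inj.
case: b ab => [f|q] ab /=; first by case: eqP.
move=> [ex]; have /andP[/eqP hp _] := valP p; have /andP[/eqP hq _] := valP q.
apply: (B2 (src G v)) => // ey; apply: ab; congr inr; apply: val_inj.
by rewrite (surjective_pairing (val p)) (surjective_pairing (val q)); congr pair.
Qed.


(** * Occurrences of symmetric paths of S' and of their projections *)

Lemma proj_inl (e : {e : E | e != v}) a : proj a = val e -> a = inl e.
Proof.
case: a => [f|p] /= h; first by congr inl; apply: val_inj.
by have := valP e; rewrite -[val e]h eqxx.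
Qed.

(** Only the indices of cross edges are lost by projecting. The first is recovered from the common
    preceding edge, the second from the following edge, which exists because the walks do not end
    with a cross edge. *)
Lemma map_proj_inj a s t : walk G1 (a :: s) -> walk G1 (a :: t) ->
  [seq proj b | b <- s] = [seq proj b | b <- t] ->
  (forall p, last a s <> inr p) -> (forall p, last a t <> inr p) -> s = t.
Proof.
elim: s a t => [|b s IH] a [|c t] //= /andP[/eqP ab ws] /andP[/eqP ac wt] [ebc est] ls lt.
have ebc' : b = c.
  case: b c ab ac ebc ws wt ls lt => [f|p] c ab ac ebc ws wt ls lt.
    by rewrite (@proj_inl f c).
  case: c ac ebc wt lt => [f|q] ac ebc wt lt; first by rewrite (@proj_inl f (inr p)).
  move/adjP: ab => ab; move/adjP: ac => ac; case: a ab ac => // e e1 e2.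
  case: s est ws ls {IH} => [|b s] est ws ls; first by case: (ls p).
  case: t est wt lt => [|c t] // [ebc2 _] /= wt lt.
  case/andP: ws wt => /eqP /adjP + _ /andP[/eqP /adjP + _].
  case: b c ebc2 {ls lt} => [f|?] // [g|?] //= fg pf qg.
  congr inr; apply: val_inj; rewrite (surjective_pairing (val p)) (surjective_pairing (val q)).
  by congr pair; [rewrite -e1 -e2 | rewrite [LHS]pf [RHS]qg].
by subst c; congr (_ :: _); apply: (IH b).
Qed.

(** An occurrence of the projection lifts to S': [s1] begins and ends with old edges, hence so does
    the matching piece of [s2], and [map_proj_inj] identifies the two. *)
Lemma occ_project s1 s2 : symmetric G1 s1 -> symmetric G1 s2 ->
  occ (project s1) (project s2) <= occ s1 s2.
Proof.
move=> /symmetricE[w1 st1 en1] /symmetricE[w2 st2 en2].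
have [e1 [he1 [s1' es1]]] := starts_old st1; have [f1 [hf1 [t1' et1]]] := ends_old en1.
have [e2 [he2 [s2' es2]]] := starts_old st2; have [f2 [hf2 [t2' et2]]] := ends_old en2.
have := projectE (etrans (esym es1) et1); rewrite -es1 => ->.
have := projectE (etrans (esym es2) et2); rewrite -es2 => ->.
set N1 := nseq _ v; set N1' := nseq _ v.
(* The position shifts by the optional leading [v] of [project s2] and shifts back by that of
   [project s1]. *)
apply: (@occ_leq _ _ _ _ _ _ (fun j => j + (src G e2 == tgt G v) - size N1)) => r1 r2 /esym.
rewrite !catA => /esym; rewrite -!catA => er.
(* The first and last edges of [s1] differ from [v], so they cannot match an added copy of [v]: the
   occurrence, stripped of its own copies, lies in the projected edges of [s2]. *)
have [q [em er1]] : exists q, [seq proj b | b <- s2] ++ nseq (tgt G f2 == src G v) v =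
     q ++ ([seq proj b | b <- s1] ++ N1' ++ r2) /\ r1 ++ N1 = nseq (src G e2 == tgt G v) v ++ q.
  move: er; rewrite (catA r1); case: (src G e2 == tgt G v) => /=; last by exists (r1 ++ N1).
  case: (r1 ++ N1) => [|z q] /=; last by case=> <- ->; exists q.
  by rewrite es1 /= => -[ev _]; case: (elimN eqP he1).
have [q' em'] : exists q', [seq proj b | b <- s2] = q ++ [seq proj b | b <- s1] ++ q'.
  move: em; case: (tgt G f2 == src G v) => /=; last by rewrite cats0; exists (N1' ++ r2).
  case/lastP: (N1' ++ r2) => [|r z].
    rewrite !cats0 et1 map_rcons cats1 -rcons_cat => /rcons_inj[_ /= fv].
    by case: (elimN eqP hf1).
  by rewrite cats1 -!rcons_cat => /rcons_inj[-> _]; exists r.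
pose t1 := take (size q) s2; pose t := take (size s1) (drop (size q) s2).
pose t2 := drop (size s1) (drop (size q) s2).
have es : s2 = t1 ++ t ++ t2 by rewrite !cat_take_drop.
have mt : [seq proj b | b <- t] = [seq proj b | b <- s1].
  by rewrite map_take map_drop em' drop_size_cat // take_size_cat // size_map.
have mt1 : size t1 = size q.
  by rewrite size_takel // -(size_map proj s2) em' size_cat leq_addr.
have ets : t = s1.
  have wt : walk G1 t by move: w2; rewrite es => /walk_cat[_] /walk_cat[].
  have lt : rcons t1' (old_edge hf1) = old_edge he1 :: s1' by rewrite -es1.
  case: (t) mt wt => [|a t0]; first by rewrite es1.
  rewrite es1 => -[ea et0] wt; have ea' : a = old_edge he1 by apply: proj_inl.
  subst a; congr (_ :: _); apply: (map_proj_inj wt) => //; first by rewrite es1 in w1.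
    have : last (proj (old_edge he1)) [seq proj b | b <- t0] = f1.
      rewrite et0; have := congr1 (fun s => last (proj (old_edge he1)) [seq proj b | b <- s]) lt.
      by rewrite map_rcons last_rcons.
    by rewrite last_map => h p lp; rewrite lp /= in h; case: (elimN eqP hf1).
  by have := congr1 (last (old_edge he1)) lt; rewrite last_rcons /= => <-.
exists t1, t2; split; first by rewrite {1}es ets.
have := congr1 size er1; rewrite 2!size_cat => e.
by rewrite mt1 addnC -[X in X + _ - _](size_nseq _ v) -e addnK.
Qed.

Lemma occurrences1 s1 s2 k : symmetric G1 s1 -> symmetric G1 s2 -> 1 <= k ->
  k <= occ (Fw S' s1) (Fw S' s2) -> k <= occ s1 s2.
Proof.
move=> sy1 sy2 k1; rewrite !Fw_project // => h.
apply: leq_trans (occ_project sy1 sy2).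
by case: scheme => _ _ _ h4 _; apply: h4 => //; apply: symmetric_project.
Qed.

(** * Lifting symmetric paths of S to S' *)

(** A passage through [v] lifts to the cross edge indexed by its two neighbours, so [v] must be
    neither first nor last. Such a step consumes two edges, hence the induction on a bound for the
    length. *)
Lemma lift_walk n (r : seq E) e (h : e != v) : size r <= n -> walk G (e :: r) -> last e r != v ->
  exists s, [/\ walk G1 (old_edge h :: s), [seq proj b | b <- s] = r &
    exists f (hf : f != v), last (old_edge h) s = old_edge hf].
Proof.
elim: n r e h => [|n IH] [|f r] e h //=; try by exists [::]; split=> //; exists e, h.
move=> le /andP[/eqP ef wr] lr; have [fv | nf] := eqVneq f v; last first.
  have [s [ws ms ls]] := IH r f nf le wr lr.
  exists (old_edge nf :: s); rewrite /= ms; split=> //; apply/andP; split=> //.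
  apply/eqP; rewrite (@tgt1_old e h) ?(@src1_old f nf) ?ef //.
  - by rewrite -ef => fv; case: (elimN eqP h); apply: tgt_support.
  by move=> fv; case: (elimN eqP nf); apply: src_support.
subst f; case: r le wr lr => [|y r] le wr lr; first by rewrite eqxx in lr.
case/andP: wr => /eqP vy wr; have hy := esym vy.
have [|s [ws ms ls]] := IH r y (leaving_neq hy) _ wr lr; first by rewrite ltnW.
exists (cross ef hy :: old_edge (leaving_neq hy) :: s); rewrite /= ms; split=> //.
by rewrite /adjacent /= ef hy !eqxx.
Qed.

(** A leading or trailing [v] is stripped before lifting and restored by [project]; the path [v]
    alone would leave nothing to lift. *)
Lemma lift_symmetric (r : seq E) : symmetric G r -> r <> [:: v] ->
  exists s, symmetric G1 s /\ project s = r.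
Proof.
move=> /symmetricE[w st en] nr.
have [e [r1 [er he]]] : exists e r1, r = nseq (src G e == tgt G v) v ++ e :: r1 /\ e != v.
  case: r w st en nr => // e r w st en nr; have [ev | ne] := eqVneq e v.
    subst e; case: r w nr {en st} => // f r /= /andP[/eqP ef _] _.
    by exists f, r; rewrite -ef eqxx; split=> //; apply: leaving_neq.
  exists e, r; split=> //; case: eqP => //= h; move: st => /=; rewrite h => c.
  by case: (distributing_not_collecting tgtvD c).
have [f [r2 [er2 hf]]] : exists f r2, e :: r1 = rcons r2 f ++ nseq (tgt G f == src G v) v /\ f != v.
  rewrite er in w en; case: (walk_cat w) => _; rewrite ends_cat // in en.
  have [r2 [f er1]] : exists r2 f, e :: r1 = rcons r2 f by exists (belast e r1), (last e r1); rewrite lastI.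
  rewrite er1 ends_rcons in en *; have [fv | nf] := eqVneq f v.
    subst f; case/lastP: r2 er1 => [[ev _]|r2 f er1]; first by rewrite ev eqxx in he.
    rewrite walk_rcons2 => /andP[_ /eqP fv].
    by exists f, r2; rewrite fv eqxx cats1; split=> //; apply: entering_neq.
  move=> _; exists f, r2; split=> //; case: eqP => h; rewrite ?cats0 //; move: en; rewrite h => d.
  by case: (distributing_not_collecting d).
have [r3 er3] : exists r3, rcons r2 f = e :: r3.
  by case: (r2) er2 => [|z r3] [-> _]; [exists [::] | exists (rcons r3 f)].
have l3 : last e r3 = f by have := congr1 (last e) er3; rewrite last_rcons.
have w3 : walk G (e :: r3).
  by move: w; rewrite er er2 er3 => /walk_cat[_ /walk_cat[]].
have [|s [ws ms [f' [hf' ls]]]] := lift_walk he (leqnn (size r3)) w3; first by rewrite l3.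
have ff : f' = f.
  have : proj (last (old_edge he) s) = f' by rewrite ls.
  by rewrite -last_map ms l3.
subst f'; have hs : old_edge he :: s = rcons (belast (old_edge he) s) (old_edge hf').
  by rewrite -ls lastI.
exists (old_edge he :: s); split; last first.
  by rewrite (projectE hs) map_cons ms [proj _]/= -er3 -er2 -er.
apply/symmetricE; split=> //.
  rewrite /=; case: eqP => h; first exact: B_collecting.
  by move: st; rewrite er; case: eqP => //= _; apply: collecting_old => /src_support ev; case: (elimN eqP he).
rewrite hs ends_rcons /=; case: eqP => h; first exact: A_distributing.
move: en; rewrite er ends_cat // er2; case: eqP => //= _; rewrite cats0 ends_rcons.
by apply: distributing_old => /tgt_support ev; case: (elimN eqP hf').
Qed.

Lemma through_leaving y (r : seq E) : src G y = tgt G v -> symmetric G r -> y \in r ->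
  exists r1 r2, r = r1 ++ v :: y :: r2.
Proof.
move=> hy /symmetricE[w st en] /splitPr er; case: er w st en => r1 r2.
case/lastP: r1 => [|r1 z].
  by move=> _ /=; rewrite hy => /(distributing_not_collecting tgtvD).
rewrite walk_glue => /and3P[_ /eqP zy _] _ _; exists r1, r2.
by rewrite cat_rcons (tgt_support (etrans zy hy)).
Qed.

(** If the covering path in S is [v] alone, it is replaced by a symmetric path through some [y_j],
    obtained from (7) and (6). Such a path contains [v], so its word contains [V]. *)
Lemma covered1 u : factorW u W -> exists s, symmetric G1 s /\ infix u (Fw S' s).
Proof.
move=> fu; case: (scheme) => _ _ FB _ [_ cov forced].
have [r [symr ur]] := cov u fu.
have [r' [symr' ur' nr']] : exists r', [/\ symmetric G r', infix u (Fw S r') & r' <> [:: v]].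
  have [rv|] := eqVneq r [:: v]; last by move=> /eqP nr; exists r.
  have [_ [y [_ [_ [hy _]]]]] := tgtvD.
  have [w [fw hw]] := forced y; have [t [symt ut]] := cov w fw.
  have [t1 [t2 et]] := through_leaving hy symt (hw t symt ut).
  exists t; split=> //; last by rewrite et; case: (t1) => [|? []].
  apply: infix_trans ur _; rewrite rv; rewrite et -cat1s in symt *.
  by rewrite (Fw_sub FB symt) ?infix_mid //; split.
have [s [sym ps]] := lift_symmetric symr' nr'.
by exists s; rewrite Fw_project // ps.
Qed.

(** * Forcing factors and good edges *)

Lemma forced_old e (h : e != v) : exists u, factorW u W /\
  forall s, symmetric G1 s -> infix u (Fw S' s) -> old_edge h \in s.
Proof.
case: (scheme) => _ _ _ _ [_ _ /(_ e) [u [fu hu]]]; exists u; split=> // s sym.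
rewrite Fw_project // => /(hu _ (symmetric_project sym)).
case: s sym => // a s _; rewrite /project !mem_cat !mem_nseq (negbTE h) !andbF orbF /=.
move=> h'; have /mapP[b bs eb] : e \in [seq proj b | b <- a :: s] by [].
by have <- : b = old_edge h by apply: (@proj_inl (exist _ e h)); rewrite -eb.
Qed.

(** The left core has F equal to its B, namely [X_i V]; then the cross edge adds [Y_j], while [y_j]
    adds nothing because it leaves a collecting vertex. The two halves are separate hypotheses so
    that they may come from different paths. *)
Lemma cross_core x y (hx : tgt G x = src G v) (hy : src G y = tgt G v) s t :
  walk G1 (rcons s (old_edge (entering_neq hx))) ->
  starts G1 (collecting G1) (rcons s (old_edge (entering_neq hx))) ->
  walk G1 (old_edge (leaving_neq hy) :: t) ->
  ends G1 (distributing G1) (old_edge (leaving_neq hy) :: t) ->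
  exists s0 l r t0,
    let c := rcons l (old_edge (entering_neq hx)) ++ cross hx hy :: old_edge (leaving_neq hy) :: r in
    [/\ s = s0 ++ l, t = r ++ t0, symmetric G1 c & Fw S' c = back S x ++ Vword S v ++ front S y].
Proof.
set X := old_edge _; set Y := old_edge _ => ws ss wt et.
have [s0 [l [es sl bl0]]] := left_core (S := S') ws ss.
have [r [t0 [et0 er fr]]] := right_core (S := S') wt et.
exists s0, l, r, t0 => c; split=> //.
  apply/symmetricE; split.
  - rewrite walk_glue; apply/and3P; split.
    + by move: ws; rewrite es rcons_cat => /walk_cat[].
    + by rewrite /= hx eqxx.
    rewrite /= /adjacent /= hy eqxx /=; apply/andP; split=> //.
    by move: wt; rewrite et0 -cat_cons => /walk_cat[].
  - by rewrite starts_cat //; case: (l).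
  by rewrite ends_cat.
have symX : symmetric G1 (rcons l X).
  apply/symmetricE; split=> //; last by rewrite ends_rcons /= hx eqxx; apply: A_distributing.
  by move: ws; rewrite es rcons_cat => /walk_cat[].
rewrite /c Fw_cat; last by case: (l).
rewrite F_eq_B1 // Bw_rcons bl0 !fl_cons fr forks_inr forks_inl hy eqxx andbF /= hx eqxx.
by rewrite !cats0 -catA.
Qed.

(** For a cross edge, a path through [x_i] and a path through [y_j] supply the two halves of a core
    with word [X_i V Y_j]. Axiom (4) with [k = 1] puts this core inside every symmetric path whose
    word contains that factor. *)
Lemma forced1 a : good1 W a -> exists u, factorW u W /\
  forall s, symmetric G1 s -> infix u (Fw S' s) -> a \in s.
Proof.
case: a => [e|p]; first by rewrite old_edge_val => _; apply: forced_old.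
have [x [y [hx [hy ->]]]] := cross_val p => /= /pbP good.
have [ux [fx hux]] := forced_old (entering_neq hx); have [s [syms us]] := covered1 fx.
have [uy [fy huy]] := forced_old (leaving_neq hy); have [t [symt ut]] := covered1 fy.
have /splitPr es := hux s syms us; case: es {us} syms => s1 s2 /symmetricE[w st _].
have /splitPr et := huy t symt ut; case: et {ut} symt => t1 t2 /symmetricE[w' _ en].
rewrite -cat_rcons in w st; rewrite ends_cat // in en.
have [||//|//|s0 [l [r [t0 [_ _ symc Fc]]]]] := @cross_core x y hx hy s1 t2.
- by case: (walk_cat w).
- by move: st; rewrite starts_cat //; case: (s1).
- by case: (walk_cat w').
exists (back S x ++ Vword S v ++ front S y); split=> // q symq.
rewrite -Fc -occ_gt0 => /(occurrences1 symc symq (leqnn 1)).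
by rewrite occ_gt0 => /mem_infix; apply; rewrite mem_cat inE eqxx orbT.
Qed.

Lemma good_of_factor s : symmetric G1 s -> factorW (Fw S' s) W -> all (@good1 _ _ _ S W v) s.
Proof.
move=> sym fac; apply/allP => -[//|p]; have [x [y [hx [hy ->]]]] := cross_val p.
move=> /splitPr es; case: es sym fac => s1 s2 sym fac; apply/pbP => /=.
have [w st en] := (symmetricE _ _).1 sym.
case/lastP: s1 sym fac w st en => [|s1 a] sym fac w st en.
  by have [e [h [s' []]]] := starts_old st.
case: s2 sym fac w st en => [|b s2] sym fac w st en.
  by have [e [h [s' /rcons_inj[]]]] := ends_old (eq_rect _ _ en _ (cats1 _ _)).
move: (w); rewrite walk_glue => /and3P[w1 /eqP /adjP] + /andP[/eqP /adjP + w2].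
case: a b sym fac w st en w1 w2 => [e|?] // [f|?] // sym fac w st en w1 w2 /= ex fy.
have ea : inl e = old_edge (entering_neq hx) by congr inl; apply: val_inj.
have eb : inl f = old_edge (leaving_neq hy) by congr inl; apply: val_inj; rewrite /= -fy.
rewrite ea eb in sym fac w st en w1 w2.
have [|//||s0 [l [r [t0 [es1 es2 symc Fc]]]]] := @cross_core x y hx hy s1 s2 w1.
- by move: st; rewrite starts_cat //; case: (s1).
- by rewrite ends_cat in en.
rewrite -Fc; apply: factorW_infix fac.
set c := _ ++ _ in symc Fc *.
have ec : rcons s1 (old_edge (entering_neq hx)) ++ cross hx hy :: old_edge (leaving_neq hy) :: s2 =
   s0 ++ c ++ t0 by rewrite es1 es2 /c rcons_cat -!catA.
by rewrite ec in sym *; rewrite (@Fw_sub _ _ _ S' F_eq_B1 _ _ _ sym symc) infix_mid.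
Qed.

End Split.

(** * The graph S'' *)

Section Evolution.
Variables (A : eqType) (V E : finType) (S : gwords A V E) (W : nat -> A) (v : E).
Hypothesis rec : recurrent W.
Hypothesis scheme : rauzy_scheme S W.
Hypothesis supp : support_edge (gr S) v.

Let S' := S1 S v.
Let G1 := S1graph S v.
Let G2 := S2graph S W v.
Notation good := (@good1 A V E S W v).
Notation pers := (persistent S W v).

Implicit Types (a b : E1 S v) (s t : seq (E1 S v)) (c d : E2 S W v) (p q : seq (E2 S W v)).

Let deg1 : fork_or_join G1 := fork_or_join1 scheme supp.
Let FB1 s : symmetric G1 s -> Fw S' s = Bw S' s := @F_eq_B1 _ _ _ _ _ _ scheme supp s.
Let cov1 u : factorW u W -> exists s, symmetric G1 s /\ infix u (Fw S' s) :=
  @covered1 _ _ _ _ _ _ scheme supp u.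

(** * Connecting good edges by good paths *)

Lemma good_admissible u1 u2 n : factorW u1 W -> factorW u2 W ->
  exists t1 m t2, [/\ symmetric G1 (t1 ++ m ++ t2), factorW (Fw S' (t1 ++ m ++ t2)) W,
    all good (t1 ++ m ++ t2), n <= size m &
    (symmetric G1 t1 /\ infix u1 (Fw S' t1)) /\ (symmetric G1 t2 /\ infix u2 (Fw S' t2))].
Proof.
move=> f1 f2; have [t1 [m [t2 [sy fac h1 h2 sz]]]] := @admissible_path _ _ _ S' _ rec FB1 cov1 u1 u2 n f1 f2.
by exists t1, m, t2; split=> //; apply: good_of_factor.
Qed.

(** A long [m] allows a deterministic walk from [a], or one into [b], to be found inside a path
    whose word is a factor of W. *)
Lemma good_connected a b n : good a -> good b ->
  exists s1 m s2, let s := s1 ++ a :: m ++ b :: s2 in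
    [/\ symmetric G1 s, factorW (Fw S' s) W, all good s & n <= size m].
Proof.
move=> ga gb; have [ua [fa ha]] := forced1 scheme supp ga.
have [ub [fb hb]] := forced1 scheme supp gb.
have [t1 [m [t2 [sy fac gs sz [[sy1 i1] [sy2 i2]]]]]] := good_admissible n fa fb.
have /splitPr e1 := ha _ sy1 i1; case: e1 sy fac gs {sy1 i1} => p1 p2.
have /splitPr e2 := hb _ sy2 i2; case: e2 {sy2 i2} => q1 q2 sy fac gs.
exists p1, (p2 ++ m ++ q1), q2 => /=.
have -> : p1 ++ a :: (p2 ++ m ++ q1) ++ b :: q2 = (p1 ++ a :: p2) ++ m ++ q1 ++ b :: q2.
  by rewrite -!catA.
by split=> //; rewrite !size_cat addnCA; apply: leq_trans sz (leq_addr _ _).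
Qed.

Lemma good_path a b : good a -> good b ->
  exists s, walk G1 (a :: rcons s b) /\ all good (rcons s b).
Proof.
move=> ga gb; have [s1 [m [s2 [/symmetricE[w _ _] _ g _]]]] := good_connected 0 ga gb.
have e : s1 ++ a :: m ++ b :: s2 = s1 ++ (a :: rcons m b) ++ s2 by rewrite cat_cons cat_rcons.
exists m; rewrite e in w g; split; first by case: (walk_cat w) => _ /walk_cat[].
by move: g; rewrite !all_cat => /and3P[_ /andP[_]].
Qed.

Lemma good_next a : good a -> exists b, good b /\ tgt G1 a = src G1 b.
Proof.
move=> ga; have [s [w g]] := good_path ga ga.
case: s w g => [|b s] /= /andP[/eqP h _] /andP[gb _]; first by exists a.
by exists b.
Qed.

Lemma good_prev a : good a -> exists b, good b /\ tgt G1 b = src G1 a.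
Proof.
move=> ga; have [s [w g]] := good_path ga ga; move: w g; rewrite -rcons_cons.
case/lastP: s => [|s b]; first by move=> /= /andP[/eqP h _] _; exists a.
by rewrite -rcons_cons walk_rcons2 !all_rcons => /andP[_ /eqP h] /and3P[_ gb _]; exists b.
Qed.

(** * Persistent vertices *)

Lemma persistentP x : reflect
  ((exists a b, [/\ good a, good b, a <> b, src G1 a = x & src G1 b = x]) \/
   (exists a b, [/\ good a, good b, a <> b, tgt G1 a = x & tgt G1 b = x])) (pers x).
Proof.
apply: (iffP orP) => -[].
- move=> /card_gt1P[a [b [/andP[ga /eqP ha] /andP[gb /eqP hb] /eqP n]]].
  by left; exists a, b.
- move=> /card_gt1P[a [b [/andP[ga /eqP ha] /andP[gb /eqP hb] /eqP n]]].
  by right; exists a, b.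
- move=> [a [b [ga gb n ha hb]]]; left; apply/card_gt1P; exists a, b.
  by split; rewrite ?inE ?ga ?gb; [apply/eqP | apply/eqP | apply/eqP].
move=> [a [b [ga gb n ha hb]]]; right; apply/card_gt1P; exists a, b.
by split; rewrite ?inE ?ga ?gb; [apply/eqP | apply/eqP | apply/eqP].
Qed.

(** Good walks are deterministic at non-persistent vertices, forwards here and backwards in
    [tgt_inj_transient]. *)
Lemma src_inj_transient a b : good a -> good b -> ~~ pers (src G1 a) ->
  src G1 a = src G1 b -> a = b.
Proof.
move=> ga gb /persistentP np ab; have [//|/eqP n] := eqVneq a b.
by case: np; left; exists a, b.
Qed.
Lemma tgt_inj_transient a b : good a -> good b -> ~~ pers (tgt G1 a) ->
  tgt G1 a = tgt G1 b -> a = b.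
Proof.
move=> ga gb /persistentP np ab; have [//|/eqP n] := eqVneq a b.
by case: np; right; exists a, b.
Qed.

Lemma persistent_out x : pers x -> exists a, good a /\ src G1 a = x.
Proof.
case/persistentP => -[a [b [ga gb n ha hb]]]; first by exists a.
by have [d [gd hd]] := good_next ga; exists d; rewrite -hd.
Qed.
Lemma persistent_in x : pers x -> exists a, good a /\ tgt G1 a = x.
Proof.
case/persistentP => -[a [b [ga gb n ha hb]]]; last by exists a.
by have [d [gd hd]] := good_prev ga; exists d; rewrite hd.
Qed.

Lemma persistent_cases x : pers x -> distributing G1 x \/ collecting G1 x.
Proof. by case/persistent_out => a [_ <-]; case: (deg1 a). Qed.

(** In-degree one excludes two good incoming edges, so persistence must come from the outgoing
    ones. *)
Lemma distributing_persistent x : pers x -> distributing G1 x ->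
  exists a b, [/\ good a, good b, a <> b, src G1 a = x & src G1 b = x].
Proof.
move=> /persistentP[//|[a [b [_ _ n ha hb]]]] dx; case: n.
by apply: (@distributing_in_inj _ _ G1); rewrite ?ha ?hb.
Qed.
Lemma collecting_persistent x : pers x -> collecting G1 x ->
  exists a b, [/\ good a, good b, a <> b, tgt G1 a = x & tgt G1 b = x].
Proof.
move=> /persistentP[[a [b [_ _ n ha hb]]]|//] dx; case: n.
by apply: (@collecting_out_inj _ _ G1); rewrite ?ha ?hb.
Qed.

(** * Edges of S'' as good paths of S' *)

Lemma S2edgeP a s : reflect
  [/\ walk G1 (a :: s), all good (a :: s), pers (src G1 a), pers (tgt G1 (last a s)) &
      all (fun b => ~~ pers (src G1 b)) s] (S2edge W (a :: s)).
Proof. exact: and5P. Qed.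

Lemma edge_cons c : exists a s, val c = a :: s.
Proof. by case: c => -[|a s] //= h; exists a, s. Qed.
Lemma edge_rcons c : exists s a, val c = rcons s a.
Proof. by have [a [s ->]] := edge_cons c; exists (belast a s), (last a s); rewrite lastI. Qed.

Lemma src2E c a s : val c = a :: s -> val (src G2 c) = src G1 a.
Proof. by move=> /= ->. Qed.
Lemma tgt2E c a s : val c = rcons s a -> val (tgt G2 c) = tgt G1 a.
Proof. by move=> /= ->; case: s => //= b s; rewrite last_rcons. Qed.

(** Interior vertices, described in [S2edge] as sources of the later edges, are also the targets of
    the earlier ones, which suits arguments from the right. *)
Lemma transient_targets a s : walk G1 (rcons s a) -> 
  all (fun b => ~~ pers (src G1 b)) (behead (rcons s a)) -> all (fun b => ~~ pers (tgt G1 b)) s.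
Proof.
case: s => // b s; rewrite rcons_cons => w /= h; have := walk_belast_tgt w.
rewrite belast_rcons => e.
have : all (fun x => ~~ pers x) [seq src G1 f | f <- rcons s a] by rewrite all_map.
by rewrite -e all_map.
Qed.

(** Interior vertices are not persistent, so the shorter path is a prefix of the longer one; a
    proper prefix would end at a persistent interior vertex of the longer. *)
Lemma edge_head_inj c d a s t : val c = a :: s -> val d = a :: t -> c = d.
Proof.
move=> ec ed; apply: val_inj; rewrite ec ed; congr (_ :: _).
have := valP c; rewrite /= ec => /S2edgeP[ws gs _ ps ns].
have := valP d; rewrite /= ed => /S2edgeP[wt gt _ pt nt].
wlog le : c d s t ec ed ws gs ps ns wt gt pt nt / size s <= size t.
  move=> h; case/orP: (leq_total (size s) (size t)) => le; first exact: (h c d s t).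
  by apply/esym/(h d c t s).
have [|r er] := walk_prefix _ gs gt ws wt le.
  move=> x y z gx gy gz xy xz ys _; apply: src_inj_transient => //; last by rewrite -xy.
  exact: (allP ns).
case: r er => [|b r] er; first by rewrite er cats0.
move: wt nt; rewrite er -cat_cons lastI walk_glue => /and3P[_ /eqP h _].
by rewrite all_cat => /and3P[_ /negP []]; rewrite -h.
Qed.

Lemma edge_last_inj c d a s t : val c = rcons s a -> val d = rcons t a -> c = d.
Proof.
move=> ec ed; apply: val_inj; rewrite ec ed; congr rcons.
have [b [s1 es1]] := edge_cons c; have [b' [t1 et1]] := edge_cons d.
have := valP c; rewrite /= es1 => /S2edgeP[ws gs ps _ ns].
have := valP d; rewrite /= et1 => /S2edgeP[wt gt pt _ nt].
have {ns} ns : all (fun b => ~~ pers (tgt G1 b)) s.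
  by apply: (@transient_targets a); rewrite -ec es1.
have {nt} nt : all (fun b => ~~ pers (tgt G1 b)) t.
  by apply: (@transient_targets a); rewrite -ed et1.
have {ps} ps : starts G1 pers (rcons s a) by rewrite -ec es1.
have {pt} pt : starts G1 pers (rcons t a) by rewrite -ed et1.
rewrite -es1 ec in ws gs; rewrite -et1 ed in wt gt.
clear b s1 es1 b' t1 et1.
wlog le : c d s t ec ed ws gs ps ns wt gt pt nt / size s <= size t.
  move=> h; case/orP: (leq_total (size s) (size t)) => le; first exact: (h c d s t).
  by apply/esym/(h d c t s).
have [|r er] := walk_suffix _ gs gt ws wt le.
  move=> x y z gx gy gz xy xz ys _; apply: tgt_inj_transient => //; last by rewrite xy.
  exact: (allP ns).
case/lastP: r er => [|r b] er; first by rewrite er.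
move: wt nt; rewrite er all_cat all_rcons rcons_cat => wt /andP[/andP[/negP h _] _]; case: h.
by move: ps; case: (rcons s a) wt => // z l; rewrite walk_glue => /and3P[_ /eqP -> _].
Qed.

(** * Unfolding paths of S'' *)

Lemma unfold2_cons c p : unfold2 (c :: p) = val c ++ unfold2 p.
Proof. by []. Qed.
Lemma unfold2_cat p q : unfold2 (p ++ q) = unfold2 p ++ unfold2 q.
Proof. by rewrite /unfold2 map_cat flatten_cat. Qed.
Lemma unfold2_rcons p c : unfold2 (rcons p c) = unfold2 p ++ val c.
Proof. by rewrite -cats1 unfold2_cat unfold2_cons cats0. Qed.
Lemma unfold2_neq0 p : p <> [::] -> unfold2 p <> [::].
Proof. by case: p => // c p _; have [a [s e]] := edge_cons c; rewrite unfold2_cons e. Qed.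

(** By [edge_head_inj], the first edge of an unfolding determines the first edge of the path, which
    can thus be read off from left to right. *)
Lemma unfold2_inj : injective (@unfold2 A V E S W v).
Proof.
elim=> [|c p IH] [|d q] //.
- by move=> /esym h; case: (@unfold2_neq0 (d :: q)).
- by move=> h; case: (@unfold2_neq0 (c :: p)).
have [a [s ec]] := edge_cons c; have [b [t ed]] := edge_cons d.
rewrite !unfold2_cons => e; have ab : a = b by move: e; rewrite ec ed => -[].
rewrite -ab in ed; have cd := edge_head_inj ec ed; subst d; congr (_ :: _); apply: IH.
by have := congr1 (drop (size (val c))) e; rewrite !drop_size_cat.
Qed.

Lemma starts_unfold2 (P : V1 V E -> Prop) p :
  starts G2 (fun x => P (val x)) p <-> starts G1 P (unfold2 p).
Proof.
case: p => // c p; have [a [s ec]] := edge_cons c.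
by rewrite unfold2_cons /starts (src2E ec) ec.
Qed.
Lemma ends_unfold2 (P : V1 V E -> Prop) p :
  ends G2 (fun x => P (val x)) p <-> ends G1 P (unfold2 p).
Proof.
case/lastP: p => // p c; have [s [a ec]] := edge_rcons c.
by rewrite unfold2_rcons ec -rcons_cat !ends_rcons (tgt2E ec).
Qed.

Lemma good_unfold2 p : all good (unfold2 p).
Proof.
elim: p => // c p IH; rewrite unfold2_cons all_cat IH andbT.
by have [a [s ec]] := edge_cons c; have := valP c; rewrite /= ec => /S2edgeP[].
Qed.

Lemma walk_edge c : walk G1 (val c).
Proof. by have [a [s ec]] := edge_cons c; have := valP c; rewrite /= ec => /S2edgeP[]. Qed.

Lemma walk_unfold2 p : walk G2 p -> walk G1 (unfold2 p).
Proof.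
elim: p => // c [|d p] IH; first by rewrite unfold2_cons cats0 => _; apply: walk_edge.
move=> /andP[/eqP cd /IH w]; have [s [a ec]] := edge_rcons c; have [b [t ed]] := edge_cons d.
rewrite unfold2_cons; move: w (walk_edge c); rewrite unfold2_cons ec ed cat_cons walk_glue => -> ->.
by rewrite andbT; apply/eqP; rewrite -(tgt2E ec) cd (src2E ed).
Qed.

(** The piece up to the first persistent target is an edge of S''; the rest is shorter and again
    starts at a persistent vertex. *)
Lemma decompose s : walk G1 s -> all good s -> starts G1 pers s -> ends G1 pers s ->
  exists p, unfold2 p = s /\ walk G2 p.
Proof.
have [n] := ubnP (size s); elim: n s => // n IH s le w g st en.
have : has (fun b => pers (tgt G1 b)) s.
  case/lastP: s en {le w g st} => // s b; rewrite ends_rcons => pb.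
  by rewrite has_rcons pb.
case/split_first => l [b [r [es pb nl]]].
have hl : S2edge W (rcons l b).
  rewrite es -cat_rcons in w g st; have [w1 _] := walk_cat w.
  move: g; rewrite all_cat => /andP[g1 _].
  have st1 : starts G1 pers (rcons l b) by move: st; rewrite starts_cat //; case: (l).
  case: l w1 nl st1 g1 {es w st} => [|z l] w1 nl st1 g1; first by apply/S2edgeP.
  rewrite rcons_cons in w1 g1 *; apply/S2edgeP; split=> //; first by rewrite last_rcons.
  have := walk_belast_tgt w1; rewrite belast_rcons => e.
  have : all (fun x => ~~ pers x) [seq tgt G1 f | f <- z :: l] by rewrite all_map.
  by rewrite e all_map.
pose c : E2 S W v := Sub (rcons l b) hl; have ec : val c = rcons l b by [].
case: r es => [|z r] es.
  by exists [:: c]; rewrite unfold2_cons cats0 ec es cats1.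
rewrite es in w g en le; rewrite -cat_rcons in w g.
have [|||||q [eq wq]] := IH (z :: r).
- by move: le; rewrite size_cat /=; lia.
- by case: (walk_cat w).
- by move: g; rewrite all_cat => /andP[].
- by move: w; rewrite walk_glue => /and3P[_ /eqP h _]; move: pb; rewrite h.
- by move: en; rewrite -cat_rcons ends_cat.
exists (c :: q); rewrite unfold2_cons eq ec es cat_rcons; split=> //.
case: q eq wq => // d q eq wq; apply/andP; split=> //.
have [y [t ed]] := edge_cons d; move: eq; rewrite unfold2_cons ed => -[ey _].
apply/eqP/val_inj; rewrite (tgt2E ec) (src2E ed) ey.
by move: w; rewrite walk_glue => /and3P[_ /eqP].
Qed.

(** A good path from [a] back to [a], without its last edge, returns to the persistent source of
    [a]; the first piece of its decomposition is the required edge. *)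
Lemma edge_from a : good a -> pers (src G1 a) -> exists c s, val c = a :: s.
Proof.
move=> ga pa; have [s [w g]] := good_path ga ga.
have [||||p [ep _]] := @decompose (a :: s).
- by move: w; rewrite -rcons_cons -cats1 => /walk_cat[w' _].
- by move: g; rewrite all_rcons => /andP[_ gs]; rewrite /= ga.
- by [].
- have := w; rewrite -rcons_cons -cats1 => /walk_join h.
  by apply/(h (fun x => pers x)).
case: p ep => // c p; have [b [t ec]] := edge_cons c.
by rewrite unfold2_cons ec => -[eb _]; exists c, t; rewrite -eb.
Qed.

Lemma edge_to a : good a -> pers (tgt G1 a) -> exists c s, val c = rcons s a.
Proof.
move=> ga pa; have [s [w g]] := good_path ga ga.
have [||||p [ep _]] := @decompose (rcons s a).
- by move: w; rewrite -cat1s => /walk_cat[_ w'].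
- by [].
- have := w; rewrite -cat1s => /walk_join h; apply/(h (fun x => pers x)) => //.
  by case: (s).
- by rewrite ends_rcons.
case/lastP: p ep => [|p c]; first by case: (s).
have [t [b ec]] := edge_rcons c; rewrite unfold2_rcons ec -rcons_cat => /rcons_inj[_ eb].
by exists c, t; rewrite -eb.
Qed.

(** * Vertex types, connectivity and finiteness of S'' *)

(** First edges give a bijection between the edges of S'' leaving [x] and the good edges of S'
    leaving it; last edges do the same for entering edges. Hence the type of a vertex is
    unchanged. *)
Lemma distributing2_of x : distributing G1 (val x) -> distributing G2 x.
Proof.
move=> dx; have px := valP x; split.
  have [a [ga ta]] := persistent_in px; have [c [s ec]] : exists c s, val c = rcons s a.
    by apply: edge_to => //; rewrite ta.
  exists c; split; first by apply: val_inj; rewrite (tgt2E ec).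
  move=> d td; have [t [b ed]] := edge_rcons d.
  have tb : tgt G1 b = val x by rewrite -(tgt2E ed) td.
  have ab : b = a by apply: (@distributing_in_inj _ _ G1); rewrite ?ta ?tb.
  by subst b; apply: edge_last_inj ed ec.
have [a [b [ga gb n ha hb]]] := distributing_persistent px dx.
have [c [s ec]] : exists c s, val c = a :: s by apply: edge_from; rewrite ?ha.
have [d [t ed]] : exists c s, val c = b :: s by apply: edge_from; rewrite ?hb.
exists c, d; split; first by move=> cd; move: ed; rewrite -cd ec => -[].
by split; apply: val_inj; rewrite ?(src2E ec) ?(src2E ed).
Qed.

Lemma collecting2_of x : collecting G1 (val x) -> collecting G2 x.
Proof.
move=> dx; have px := valP x; split; last first.
  have [a [ga ta]] := persistent_out px; have [c [s ec]] : exists c s, val c = a :: s.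
    by apply: edge_from => //; rewrite ta.
  exists c; split; first by apply: val_inj; rewrite (src2E ec).
  move=> d td; have [b [t ed]] := edge_cons d.
  have tb : src G1 b = val x by rewrite -(src2E ed) td.
  have ab : b = a by apply: (@collecting_out_inj _ _ G1); rewrite ?ta ?tb.
  by subst b; apply: edge_head_inj ed ec.
have [a [b [ga gb n ha hb]]] := collecting_persistent px dx.
have [c [s ec]] : exists c s, val c = rcons s a by apply: edge_to; rewrite ?ha.
have [d [t ed]] : exists c s, val c = rcons s b by apply: edge_to; rewrite ?hb.
exists c, d; split; first by move=> cd; move: ed; rewrite -cd ec => /rcons_inj[].
by split; apply: val_inj; rewrite ?(tgt2E ec) ?(tgt2E ed).
Qed.

Lemma distributing2E x : distributing G2 x <-> distributing G1 (val x).
Proof.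
split=> [d|]; last exact: distributing2_of.
case: (persistent_cases (valP x)) => // /collecting2_of.
by move=> /(distributing_not_collecting d).
Qed.
Lemma collecting2E x : collecting G2 x <-> collecting G1 (val x).
Proof.
split=> [d|]; last exact: collecting2_of.
case: (persistent_cases (valP x)) => // /distributing2_of h.
by case: (distributing_not_collecting h d).
Qed.

Lemma vertex_cases2 x : distributing G2 x \/ collecting G2 x.
Proof. by rewrite distributing2E collecting2E; apply: persistent_cases (valP x). Qed.

Lemma symmetric_unfold2 p : walk G2 p -> symmetric G2 p <-> symmetric G1 (unfold2 p).
Proof.
have stE : starts G2 (collecting G2) p <-> starts G1 (collecting G1) (unfold2 p).
  apply: iff_trans (starts_unfold2 (collecting G1) p).
  by split; apply: starts_sub => x; case: (collecting2E x).
have enE : ends G2 (distributing G2) p <-> ends G1 (distributing G1) (unfold2 p).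
  apply: iff_trans (ends_unfold2 (distributing G1) p).
  by split; apply: ends_sub => x; case: (distributing2E x).
move=> w; split=> /symmetricE[_ st en]; apply/symmetricE; split=> //;
  by [apply: walk_unfold2 | apply/stE | apply/enE].
Qed.

(** A good path from a good edge leaving [x] to a good edge entering [y] runs between persistent
    vertices, so it is an unfolding. *)
Lemma strongly_connected2 : strongly_connected G2.
Proof.
move=> x y; right.
have [a [ga sa]] := persistent_out (valP x); have [b [gb tb]] := persistent_in (valP y).
have [s [w g]] := good_path ga gb.
have [||||p [ep wp]] := @decompose (a :: rcons s b) => //.
- by rewrite /= ga.
- by rewrite /= -[src1 a]/(src G1 a) sa; apply: (valP x).
- by rewrite -rcons_cons ends_rcons tb; apply: (valP y).
have stp : starts G2 (eq x) p.
  apply: (starts_sub (P := fun z => val x = val z)); first by move=> z /val_inj.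
  by apply/starts_unfold2; rewrite ep.
have enp : ends G2 (eq y) p.
  apply: (ends_sub (P := fun z => val y = val z)); first by move=> z /val_inj.
  by apply/ends_unfold2; rewrite ep -rcons_cons ends_rcons.
by exists p; case: p wp stp enp {ep} => // c p.
Qed.

(** Each edge of S' is the first edge of at most one edge of S''; the list is built along the
    enumeration of the edges of S'. *)
Lemma finite_edges2 : finite_type (E2 S W v).
Proof.
suff [l hl] : exists l : seq (E2 S W v), forall c a s, val c = a :: s -> a \in enum (E1 S v) -> c \in l.
  by exists l => c; have [a [s ec]] := edge_cons c; apply: (hl c a s); rewrite ?mem_enum.
elim: (enum (E1 S v)) => [|b l [l2 IH]]; first by exists [::].
have [[c [s ec]]|nc] :=
    ClassicalEpsilon.excluded_middle_informative (exists c s, val c = b :: s).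
  exists (c :: l2) => d a t ed; rewrite !inE => /orP[/eqP ab|/(IH d a t ed) ->]; last by rewrite orbT.
  by rewrite ab in ed; rewrite (edge_head_inj ed ec) eqxx.
exists l2 => d a t ed; rewrite !inE => /orP[/eqP ab|/(IH d a t ed) //].
by case: nc; exists d, t; rewrite -ab.
Qed.

Lemma finite_vertices2 : finite_type (V2 S W v).
Proof. by exists (enum (V2 S W v)) => x; rewrite mem_enum. Qed.

Lemma graph_ok2 : graph_ok G2.
Proof.
split; [exact: finite_vertices2 | exact: finite_edges2 | exact: strongly_connected2 |].
exact: vertex_cases2.
Qed.

(** Every vertex of S'' is distributing or collecting, which is incompatible with having both
    degrees one; so S'' can be a cycle only by having no vertices. *)
Lemma cycle_no_persistent : is_cycle G2 -> forall x, ~~ pers x.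
Proof.
move=> [_ cyc] x; apply/negP => px; pose y : V2 S W v := exist _ x px.
have [[e [_ ie]] [f [_ of_]]] := cyc y.
case: (vertex_cases2 y) => [[_ [e1 [e2 [n [h1 h2]]]]]|[[e1 [e2 [n [h1 h2]]]] _]]; apply: n.
  by rewrite (of_ _ h1) (of_ _ h2).
by rewrite (ie _ h1) (ie _ h2).
Qed.

Lemma persistent_of_not_cycle : ~ is_cycle G2 -> exists x, pers x.
Proof.
move=> nc; have [//|np] :=
  ClassicalEpsilon.excluded_middle_informative (exists x, pers x).
by case: nc; split; [exact: strongly_connected2 | move=> x; case: np; exists (val x); apply: valP].
Qed.

(** * The axioms of a Rauzy scheme for S'' *)

Section NotCycle.
Variable x0 : V2 S W v.
Variables Fr Bk : E2 S W v -> seq A.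
Hypothesis FrE : forall c p, natRext G2 c p -> Fr c = Fw S' (unfold2 p).
Hypothesis BkE : forall c p, natLext G2 c p -> Bk c = Bw S' (unfold2 p).
Let S'' := GW G2 Fr Bk.

Let deg2 : fork_or_join G2.
Proof. by move=> c; split; apply: vertex_cases2. Qed.

Let natRext2 c : exists p, natRext G2 c p :=
  natRext_exists finite_vertices2 finite_edges2 vertex_cases2 strongly_connected2 c.
Let natLext2 c : exists p, natLext G2 c p :=
  natLext_exists finite_vertices2 finite_edges2 vertex_cases2 strongly_connected2 c.

Lemma forks_unfold2 c a s : val c = a :: s -> forks S'' c = forks S' a.
Proof.
move=> ec; rewrite /forks /=; apply/pbP/pbP => d.
  by rewrite -[src1 a]/(src G1 a) -(src2E ec); apply/distributing2E.
by apply/distributing2E; rewrite -[src2 c]/(src G2 c) (src2E ec).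
Qed.

Lemma joins_unfold2 c a s : val c = rcons s a -> joins S'' c = joins S' a.
Proof.
move=> ec; rewrite /joins /=; apply/pbP/pbP => d.
  by rewrite -[tgt1 a]/(tgt G1 a) -(tgt2E ec); apply/collecting2E.
by apply/collecting2E; rewrite -[tgt2 c]/(tgt G2 c) (tgt2E ec).
Qed.

(** The initial block of [p], up to the first distributing vertex reached, is the natural right
    extension of its first edge, so that edge's front word is the F of the unfolded block and the
    other edges of the block add nothing. What follows leaves a distributing vertex, so it
    contributes its own F and the induction applies. *)
Lemma Fw_unfold2 p : walk G2 p -> ends G2 (distributing G2) p -> Fw S'' p = Fw S' (unfold2 p).
Proof.
have [n] := ubnP (size p); elim: n p => // n IH p le w en.
have : has (fun c => pb (distributing G2 (tgt G2 c))) p.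
  by case/lastP: p en {le w} => // p c; rewrite ends_rcons has_rcons => /pbP ->.
case/split_first => l [c [q [ep /pbP dc nl]]].
have [d [r er]] : exists d r, rcons l c = d :: r by case: (l) => [|d r]; [exists c, [::] | exists d, (rcons r c)].
rewrite -cat_rcons er in ep; rewrite ep in w en le *.
have [w1 w2] := walk_cat w; have en1 : ends G2 (distributing G2) (d :: r) by rewrite -er ends_rcons.
have ebl : belast d r = l by move: er; rewrite [d :: r]lastI => /rcons_inj[].
have fr : fl S'' r = [::] by apply: (@fl_belast _ _ _ S'' d); rewrite ?ebl.
have nr : natRext G2 d (d :: r).
  apply: natRext_first => //.
  have : all (fun x => ~~ pb (distributing G2 x)) [seq tgt G2 f | f <- belast d r] by rewrite all_map ebl.
  by rewrite walk_belast_tgt // all_map.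
have Fdr : Fw S'' (d :: r) = Fw S' (unfold2 (d :: r)) by rewrite Fw_cons fr cats0 -(FrE nr).
have U0 : unfold2 (d :: r) <> [::] by apply: unfold2_neq0.
rewrite Fw_cat // Fdr unfold2_cat (Fw_cat S' _ U0).
congr (_ ++ _); case: q ep w2 en w le => [|e q] // ep w2 en w le.
have fe : forks S'' e.
  by move: w; rewrite -er walk_glue => /and3P[_ /eqP ce _]; apply/pbP; rewrite /= -[src2 e]/(src G2 e) -ce.
have [a [s ee]] := edge_cons e.
rewrite fl_forks // IH //.
- by rewrite unfold2_cons ee cat_cons fl_forks // -(forks_unfold2 ee).
- by move: le; rewrite size_cat /=; lia.
by rewrite ends_cat in en.
Qed.

Lemma Bw_unfold2 p : walk G2 p -> starts G2 (collecting G2) p -> Bw S'' p = Bw S' (unfold2 p).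
Proof.
have [n] := ubnP (size p); elim: n p => // n IH p le w en.
have : has (fun c => pb (collecting G2 (src G2 c))) p.
  by case: p en {le w} => //= c p /pbP ->.
case/split_last => q [c [l [ep /pbP dc nl]]].
have [r [d er]] : exists r d, c :: l = rcons r d by exists (belast c l), (last c l); rewrite lastI.
rewrite ep in w en le *.
have [w1 w2] := walk_cat w; have en1 : starts G2 (collecting G2) (c :: l) by [].
have ebl : belast c l = r by move: er; rewrite lastI => /rcons_inj[].
have br : bl S'' r = [::] by rewrite -ebl; apply: (@bl_belast _ _ _ S'').
have nr : natLext G2 d (c :: l).
  rewrite er; apply: natLext_last => //; rewrite -?er //.
  have : all (fun x => ~~ pb (collecting G2 x)) [seq src G2 f | f <- l] by rewrite all_map.
  by rewrite -(walk_belast_tgt w2) all_map ebl.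
have Fdr : Bw S'' (c :: l) = Bw S' (unfold2 (c :: l)) by rewrite {1}er Bw_rcons br -(BkE nr).
have U0 : unfold2 (c :: l) <> [::] by apply: unfold2_neq0.
rewrite Bw_cat // Fdr unfold2_cat (Bw_cat S' _ U0).
congr (_ ++ _); case/lastP: q ep w1 en w le => [|q e] // ep w1 en w le.
have je : joins S'' e.
  by move: w; rewrite walk_glue => /and3P[_ /eqP ce _]; apply/pbP; rewrite /= -[tgt2 e]/(tgt G2 e) ce.
have [s [a ee]] := edge_rcons e.
rewrite bl_joins // IH //.
- by rewrite unfold2_rcons ee -rcons_cat bl_joins // -(joins_unfold2 ee).
- by move: le; rewrite size_cat /=; lia.
by move: en; rewrite starts_cat //; case: (q).
Qed.

Lemma Fw_symmetric2 p : symmetric G2 p -> Fw S'' p = Fw S' (unfold2 p) /\ symmetric G1 (unfold2 p).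
Proof.
move=> sy; have [w _ en] := (symmetricE _ _).1 sy.
by split; [apply: Fw_unfold2 | apply/symmetric_unfold2].
Qed.

Lemma F_eq_B2 p : symmetric G2 p -> Fw S'' p = Bw S'' p.
Proof.
move=> sy; have [w st _] := (symmetricE _ _).1 sy; have [-> sy1] := Fw_symmetric2 sy.
by rewrite Bw_unfold2 // FB1.
Qed.

Lemma persistent_ends p : p <> [::] -> starts G1 pers (unfold2 p) /\ ends G1 pers (unfold2 p).
Proof.
move=> np; split; first by apply/starts_unfold2; case: p np => // c p _; apply: valP.
by apply/ends_unfold2; case/lastP: p np => // p c _; rewrite ends_rcons; apply: valP.
Qed.

(** The pieces of [unfold2 p2] before and after an occurrence of [unfold2 p1] are empty or good
    walks between persistent vertices, hence unfoldings; injectivity of unfolding then gives an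
    occurrence of [p1] in [p2]. *)
Lemma occ_unfold2 p1 p2 : symmetric G2 p1 -> symmetric G2 p2 ->
  occ (unfold2 p1) (unfold2 p2) <= occ p1 p2.
Proof.
move=> /symmetricE[w1 st1 _] /symmetricE[w2 st2 _].
have n1 : p1 <> [::] by case: (p1) st1.
have n2 : p2 <> [::] by case: (p2) st2.
have [s1 e1] := persistent_ends n1; have [s2 e2] := persistent_ends n2.
apply: (@occ_leq _ _ _ _ _ _ (fun j => size (unfold2 (take j p2)))) => t1 t2 et.
have w := walk_unfold2 w2; have g := good_unfold2 p2; rewrite et in w g s2 e2.
have u1 := unfold2_neq0 n1; have [wt1 w'] := walk_cat w; have [_ wt2] := walk_cat w'.
move: g; rewrite !all_cat => /and3P[gt1 _ gt2].
have [q1 eq1] : exists q1, unfold2 q1 = t1.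
  have [->|/eqP nt1] := eqVneq t1 [::]; first by exists [::].
  have [||||q1 [<- _]] := @decompose t1 => //; last by exists q1.
    by rewrite starts_cat in s2.
  apply/(walk_join _ w) => //; first by case: (unfold2 p1) u1.
  by rewrite starts_cat.
have [q2 eq2] : exists q2, unfold2 q2 = t2.
  have [->|/eqP nt2] := eqVneq t2 [::]; first by exists [::].
  have [||||q2 [<- _]] := @decompose t2 => //; last by exists q2.
    by apply/(walk_join _ w').
  by move: e2; rewrite catA ends_cat.
have ep2 : p2 = q1 ++ p1 ++ q2 by apply: unfold2_inj; rewrite !unfold2_cat eq1 eq2.
exists q1, q2; split=> //; by rewrite {1}ep2 take_size_cat // eq1.
Qed.

(** Distinct edges of S'' have distinct first edges in S', and the front word of an edge begins with
    that of its first edge. *)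
Lemma front_distinct2 x c d : distributing G2 x -> c <> d -> src G2 c = x -> src G2 d = x ->
  exists l1 w1 l2 w2, [/\ Fr c = l1 :: w1, Fr d = l2 :: w2 & l1 <> l2].
Proof.
move=> /distributing2E dx ncd sc sd.
have [a [s ec]] := edge_cons c; have [b [t ed]] := edge_cons d.
have [|||l1 [w1 [l2 [w2 [h1 h2 nl]]]]] := @front_distinct1 _ _ _ _ _ _ scheme supp _ a b dx.
- by move=> ab; apply: ncd; subst b; apply: edge_head_inj ec ed.
- by rewrite -(src2E ec) sc.
- by rewrite -(src2E ed) sd.
have F e z r : val e = z :: r -> exists u, Fr e = front S' z ++ u.
  move=> ee; have [p nr] := natRext2 e.
  have [p' [ep _ _ _]] := nr.
  by rewrite (FrE nr) ep unfold2_cons ee cat_cons Fw_cons; eexists.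
have [u1 ->] := F _ _ _ ec; have [u2 ->] := F _ _ _ ed.
by exists l1, (w1 ++ u1), l2, (w2 ++ u2); rewrite h1 h2.
Qed.

Lemma back_distinct2 x c d : collecting G2 x -> c <> d -> tgt G2 c = x -> tgt G2 d = x ->
  exists l1 w1 l2 w2, [/\ Bk c = rcons w1 l1, Bk d = rcons w2 l2 & l1 <> l2].
Proof.
move=> /collecting2E dx ncd sc sd.
have [s [a ec]] := edge_rcons c; have [t [b ed]] := edge_rcons d.
have [|||l1 [w1 [l2 [w2 [h1 h2 nl]]]]] := @back_distinct1 _ _ _ _ _ _ scheme supp _ a b dx.
- by move=> ab; apply: ncd; subst b; apply: edge_last_inj ec ed.
- by rewrite -(tgt2E ec) sc.
- by rewrite -(tgt2E ed) sd.
have F e z r : val e = rcons r z -> exists u, Bk e = u ++ back S' z.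
  move=> ee; have [p nr] := natLext2 e.
  have [p' [ep _ _ _]] := nr.
  by rewrite (BkE nr) ep unfold2_rcons ee -rcons_cat Bw_rcons; eexists.
have [u1 ->] := F _ _ _ ec; have [u2 ->] := F _ _ _ ed.
by exists l1, (u1 ++ w1), l2, (u2 ++ w2); rewrite h1 h2 !rcons_cat.
Qed.

Lemma edge_tail_transient d a t b : val d = a :: t -> b \in t -> ~~ pers (src G1 b).
Proof.
by move=> ed bt; have := valP d; rewrite /= ed => /S2edgeP[_ _ _ _ /allP]; apply.
Qed.

Lemma edge_init_transient d a t b : val d = rcons t a -> b \in t -> ~~ pers (tgt G1 b).
Proof.
move=> ed; have [z [s es]] := edge_cons d; have := valP d; rewrite /= es => /S2edgeP[w _ _ _ ns].
have nt : all (fun b => ~~ pers (tgt G1 b)) t by apply: (@transient_targets a); rewrite -ed es.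
exact: (allP nt).
Qed.

(** After its first edge [h], the unfolded natural extension passes only through non-persistent or
    collecting vertices, so it is the only good continuation of [h]. It therefore occurs in any long
    enough good path through [h], in particular in one whose word is a factor of W. *)
Lemma factor_Fr c : factorW (Fr c) W.
Proof.
have [p nr] := natRext2 c; rewrite (FrE nr); case: (nr) => q [ep wp dp _].
have := nr; rewrite {1}ep => /natRext_transient nd.
have [h [s ec]] := edge_cons c; have eu : unfold2 p = h :: (s ++ unfold2 q) by rewrite ep unfold2_cons ec.
set rest := s ++ unfold2 q in eu.
have wu : walk G1 (h :: rest) by rewrite -eu; apply: walk_unfold2; move: wp; rewrite is_pathE => /andP[].
have gu : all good (h :: rest) by rewrite -eu good_unfold2.
have gh : good h by case/andP: gu.
have [s1 [m [s2 [sy fac g sz]]]] := good_connected (size rest) gh gh.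
have [w st en] := (symmetricE _ _).1 sy.
have [||||t et] := walk_prefix (R := good) (e := h) (s := rest) (t := m ++ h :: s2) _ gu _ wu.
- move=> x y z gx gy gz xy xz + _; rewrite mem_cat => /orP[ys|].
    apply: src_inj_transient => //; last by rewrite -xy.
    exact: edge_tail_transient ec ys.
  move=> /flatten_mapP[d dq yd]; have [a [t ed]] := edge_cons d.
  have := yd; rewrite ed inE => /orP[/eqP ya|yt].
    apply/esym/(@collecting_out_inj _ _ G1); last by rewrite -xy -xz.
    rewrite ya -(src2E ed); apply/collecting2E.
    by case: (vertex_cases2 (src G2 d)) => // dd; have /pbP := allP nd d dq.
  apply: src_inj_transient => //; last by rewrite -xy.
  exact: edge_tail_transient ed yt.
- by move: g; rewrite all_cat => /andP[].
- by case: (walk_cat w).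
- by rewrite [leqRHS]size_cat; apply: leq_trans sz (leq_addr _ _).
clearbody rest; apply: factorW_infix fac; rewrite eu et -cat_cons.
(* If [h] forks, the contribution of [h :: rest] inside the path is its full F. Otherwise [h] starts
   at a collecting vertex, [h :: rest] is symmetric and [Fw_sub] applies. *)
have [fh|nfh] := boolP (forks S' h).
  have n1 : s1 <> [::].
    by move=> s10; move: st fh; rewrite s10 /= => c1 /pbP d1; apply: (distributing_not_collecting d1).
  by rewrite (Fw_cat S' _ n1) (fl_cat S' (h :: rest)) (fl_forks _ fh) infix_mid.
have syr : symmetric G1 (h :: rest).
  apply/symmetricE; split=> //.
    by case: (deg1 h) => -[] // d; move/pbP: nfh.
  rewrite -eu; apply/ends_unfold2; rewrite ep; apply: ends_sub (_ : ends G2 (distributing G2) (c :: q)) => //.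
  by move=> x /distributing2E.
have syt : symmetric G1 (s1 ++ (h :: rest) ++ t) by move: sy; rewrite et.
by rewrite (@Fw_sub _ _ _ S' FB1 _ _ _ syt syr) infix_mid.
Qed.

Lemma factor_Bk c : factorW (Bk c) W.
Proof.
have [p nr] := natLext2 c; rewrite (BkE nr); case: (nr) => q [ep wp dp _].
have := nr; rewrite {1}ep => /natLext_transient nd.
have [s [h ec]] := edge_rcons c.
have eu : unfold2 p = rcons (unfold2 q ++ s) h by rewrite ep unfold2_rcons ec rcons_cat.
set rest := unfold2 q ++ s in eu.
have wu : walk G1 (rcons rest h) by rewrite -eu; apply: walk_unfold2; move: wp; rewrite is_pathE => /andP[].
have gu : all good (rcons rest h) by rewrite -eu good_unfold2.
have gh : good h by move: gu; rewrite all_rcons => /andP[].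
have [s1 [m [s2 [sy fac g sz]]]] := good_connected (size rest) gh gh.
have es : s1 ++ h :: m ++ h :: s2 = rcons (s1 ++ h :: m) h ++ s2 by rewrite cat_rcons -catA.
rewrite es in sy fac g.
have [w st en] := (symmetricE _ _).1 sy.
have [||||t et] := walk_suffix (R := good) (e := h) (s := rest) (t := s1 ++ h :: m) _ gu _ wu.
- move=> x y z gx gy gz xy xz + _; rewrite mem_cat => /orP[|ys]; last first.
    apply: tgt_inj_transient => //; last by rewrite xy.
    exact: edge_init_transient ec ys.
  move=> /flatten_mapP[d dq yd]; have [t [a ed]] := edge_rcons d.
  have := yd; rewrite ed mem_rcons inE => /orP[/eqP ya|yt].
    apply/esym/(@distributing_in_inj _ _ G1); last by rewrite xy xz.
    rewrite ya -(tgt2E ed); apply/distributing2E.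
    by case: (vertex_cases2 (tgt G2 d)) => // dd; have /pbP := allP nd d dq.
  apply: tgt_inj_transient => //; last by rewrite xy.
  exact: edge_init_transient ed yt.
- by move: g; rewrite all_cat => /andP[].
- by case: (walk_cat w).
- rewrite [leqRHS]size_cat; apply: leq_trans sz _; rewrite /= addnS -addSn; exact: leq_addl.
clearbody rest; apply: factorW_infix fac; rewrite eu (FB1 sy) et rcons_cat -catA.
have [fh|nfh] := boolP (joins S' h).
  have n1 : s2 <> [::].
    move=> s10; move: en fh; rewrite s10 cats0 ends_rcons => c1 /pbP d1.
    exact: (distributing_not_collecting c1).
  by rewrite catA (Bw_cat S' _ n1) (bl_cat S' t) (bl_joins _ fh) -catA infix_mid.
have syr : symmetric G1 (rcons rest h).
  apply/symmetricE; split=> //; last first.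
    by rewrite ends_rcons; case: (deg1 h) => _ [] // d; move/pbP: nfh.
  rewrite -eu; apply/starts_unfold2; rewrite ep.
  apply: (starts_sub (P := collecting G2)); first by move=> x /collecting2E.
  by case: (q) dp.
have syt : symmetric G1 (t ++ rcons rest h ++ s2) by move: sy; rewrite et rcons_cat -catA.
by rewrite -(FB1 syt) -(FB1 syr) (@Fw_sub _ _ _ S' FB1 _ _ _ syt syr) infix_mid.
Qed.

(** A good symmetric path of S' carrying [u] may have non-persistent ends. It is prolonged by good
    paths to a collecting persistent vertex on the left and a distributing one on the right, which
    makes it an unfolding. *)
Lemma covered2 u : factorW u W -> exists p, symmetric G2 p /\ infix u (Fw S'' p).
Proof.
move=> fu; have [t1 [m [t2 [sy _ g _ [[sy1 i1] _]]]]] := good_admissible 0 fu fu.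
have us : infix u (Fw S' (t1 ++ m ++ t2)).
  by apply: infix_trans i1 _; rewrite Fw_cat; [exact: (infix_mid [::]) | exact: symmetric_neq0 sy1].
move: (t1 ++ m ++ t2) sy g us => s sy g us {t1 m t2 sy1 i1}.
have [w st en] := (symmetricE _ _).1 sy.
have [xc cxc] := exists_collecting finite_vertices2 finite_edges2 vertex_cases2 x0.
have [xd dxd] := exists_distributing finite_vertices2 finite_edges2 vertex_cases2 x0.
have [ec [gec sec]] := persistent_out (valP xc); have [ed [ged ted]] := persistent_in (valP xd).
have [a [s1 es1]] : exists a s1, s = a :: s1 by case: (s) st => // a s1; exists a, s1.
have [s2 [b es2]] : exists s2 b, s = rcons s2 b by exists (belast a s1), (last a s1); rewrite -lastI.
have ga : good a by move: g; rewrite es1 => /andP[].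
have gb : good b by move: g; rewrite es2 all_rcons => /andP[].
have [q1 [w1 g1]] := good_path gec ga; have [q2 [w2 g2]] := good_path gb ged.
have wf : walk G1 ((ec :: q1) ++ s ++ rcons q2 ed).
  rewrite catA es2 -(rcons_cat b); apply: walk_overlap => //.
  rewrite rcons_cat -es2 es1 -cat_rcons; apply: walk_overlap => //.
  by rewrite -es1.
have gf : all good ((ec :: q1) ++ s ++ rcons q2 ed).
  by move: g1; rewrite !all_cat all_rcons g g2 /= gec => /andP[_ ->].
have stf : starts G1 (collecting G1) ((ec :: q1) ++ s ++ rcons q2 ed).
  by rewrite /= -[src1 ec]/(src G1 ec) sec; apply/collecting2E.
have enf : ends G1 (distributing G1) ((ec :: q1) ++ s ++ rcons q2 ed).
  by rewrite -!rcons_cat ends_rcons ted; apply/distributing2E.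
have [||p [ep wp]] := decompose wf gf.
- by rewrite /= -[src1 ec]/(src G1 ec) sec; apply: valP.
- by rewrite -!rcons_cat ends_rcons ted; apply: valP.
have syf : symmetric G1 ((ec :: q1) ++ s ++ rcons q2 ed) by apply/symmetricE; split.
have syp : symmetric G2 p by apply/(symmetric_unfold2 wp); rewrite ep.
exists p; split=> //; have [-> _] := Fw_symmetric2 syp.
by rewrite ep (@Fw_sub _ _ _ S' FB1 _ _ _ syf sy); apply: infix_trans us (infix_mid _ _ _).
Qed.

(** The factor forcing the first edge of [c] in S' works: this edge leaves a persistent vertex, so
    wherever it occurs in an unfolding it is the first edge of its piece, which is then [c]. *)
Lemma forced2 c : exists u, factorW u W /\
  forall p, symmetric G2 p -> infix u (Fw S'' p) -> c \in p.
Proof.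
have [a [s ec]] := edge_cons c; have := valP c; rewrite /= ec => /S2edgeP[_ /andP[ga _] pa _ _].
have [u [fu hu]] := forced1 scheme supp ga; exists u; split=> // p sy.
have [-> sy1] := Fw_symmetric2 sy; move=> /(hu _ sy1) /flatten_mapP[d dp].
have [b [t ed]] := edge_cons d; rewrite ed inE => /orP[/eqP ab|at_].
  by rewrite ab in ec; rewrite (edge_head_inj ec ed).
by have := edge_tail_transient ed at_; rewrite pa.
Qed.

Lemma rauzy_scheme2 : rauzy_scheme S'' W.
Proof.
split.
- split; first exact: graph_ok2.
  by case: (vertex_cases2 x0) => [[_ [c [d [n _]]]]|[[c [d [n _]]] _]]; exists c, d.
- split=> x c d; [exact: front_distinct2 | exact: back_distinct2].
- exact: F_eq_B2.
- move=> p1 p2 k sy1 sy2 k1.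
  have [-> sy1'] := Fw_symmetric2 sy1; have [-> sy2'] := Fw_symmetric2 sy2.
  move=> /(occurrences1 scheme supp sy1' sy2' k1) h.
  exact: leq_trans h (occ_unfold2 sy1 sy2).
split; [|exact: covered2|exact: forced2].
by move=> c; split; [apply: factor_Fr | apply: factor_Bk].
Qed.
End NotCycle.

(** * Periodicity of W when no vertex is persistent *)

Definition has_period n (w : seq A) :=
  forall x j, j + n < size w -> nth x w (j + n) = nth x w j.

Lemma has_period_mul n k w : has_period n w -> has_period (k * n) w.
Proof.
move=> h x j; elim: k => [|k IH]; first by rewrite mul0n addn0.
by rewrite mulSn (addnC n) addnA => lt; rewrite h // IH //; lia.
Qed.

Lemma nth_flatten_nseq x k (w : seq A) j : j < k * size w ->
  nth x (flatten (nseq k w)) j = nth x w (j %% size w).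
Proof.
elim: k j => // k IH j; rewrite /= mulSn nth_cat => lt; case: ltnP => h; first by rewrite modn_small.
by rewrite IH; [rewrite -{2}(subnK h) modnDr | lia].
Qed.

Section NoPersistent.
Hypothesis transient : forall x, ~~ pers x.

(** Good walks from [a] are all prefixes of the walk that repeats one closed walk through [a], so
    their words are prefixes of powers of one word. *)
Lemma fl_period a : good a -> exists2 n, 0 < n &
  forall s, walk G1 (a :: s) -> all good s -> has_period n (fl S' s).
Proof.
move=> ga; have [q [w g]] := good_path ga ga; pose l := rcons q a.
(* The maximum keeps the period positive when [fl S' l] is empty; then [fl S' s] is empty too. *)
exists (maxn 1 (size (fl S' l))); first by rewrite leq_max.
move=> s ws gs.
pose lk k := flatten (nseq k l).
have wl k : walk G1 (a :: lk k).
  elim: k => // k IH; change (walk G1 (rcons (a :: q) a ++ lk k)).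
  exact: walk_overlap.
have gl k : all good (lk k) by elim: k => // k IH; rewrite /lk /= all_cat g IH.
have fll k : fl S' (lk k) = flatten (nseq k (fl S' l)).
  by elim: k => // k IH; rewrite /lk /= fl_cat -/(lk k) IH.
have sl k : size (lk k) = k * size l.
  by rewrite size_flatten /shape map_nseq sumn_nseq mulnC.
have [||||r er] := walk_prefix (R := good) (e := a) (s := s) (t := lk (size s)) _ _ _ ws (wl _).
- by move=> x y z _ gy gz xy xz _ _; apply: src_inj_transient => //; rewrite -xy.
- by rewrite /= ga.
- by rewrite /= ga gl.
- by rewrite sl size_rcons leq_pmulr.
have efl : flatten (nseq (size s) (fl S' l)) = fl S' s ++ fl S' r by rewrite -fll er fl_cat.
have := congr1 size efl; rewrite size_flatten /shape map_nseq sumn_nseq mulnC size_cat => sz x j lt.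
have [w0 | wp] := posnP (size (fl S' l)); first by move: sz; rewrite w0; lia.
have nthE i : i < size (fl S' s) -> nth x (fl S' s) i = nth x (fl S' l) (i %% size (fl S' l)).
  by move=> lti; rewrite -(@nth_flatten_nseq x (size s)) ?efl ?nth_cat ?lti //; lia.
have em : maxn 1 (size (fl S' l)) = size (fl S' l) by lia.
by rewrite em in lt *; rewrite !nthE ?modnDr //; lia.
Qed.

Lemma periodic_of_transient : periodic W.
Proof.
have [f fP] : exists f : E1 S v -> nat, forall a, 0 < f a /\ (good a ->
    forall s, walk G1 (a :: s) -> all good s -> has_period (f a) (fl S' s)).
  apply: (@fin_all_exists _ _ (fun a n => 0 < n /\ (good a -> forall s, walk G1 (a :: s) ->
    all good s -> has_period n (fl S' s)))) => a.
  by have [/fl_period[n n0 h]|ng] := boolP (good a); [exists n | exists 1].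
(* A common multiple of the periods for all edges, since the first edge of the path carrying a given
   prefix of W is not known in advance. *)
pose P := \prod_a f a; have P0 : 0 < P by rewrite prodn_gt0 // => a; case: (fP a).
have perW i : W (i + P) = W i.
  pose M := word_bound S'; pose n := (i + P).+1.
  (* The prefix of length [n] recurs at a position at least [M]; the [M] letters before it absorb
     the front word of the first edge, so the prefix itself lies in the periodic part. *)
  have [i' [lei' ei']] := rec (factor_subw W 0 n) M; rewrite size_subw in ei'.
  have fu := factor_subw W (i' - M) (M + n).
  have [t1 [m [t2 [sy _ g _ [[sy1 i1] _]]]]] := good_admissible 0 fu fu.
  have us : infix (subw W (i' - M) (M + n)) (Fw S' (t1 ++ m ++ t2)).
    by apply: infix_trans i1 _; rewrite Fw_cat; [exact: (infix_mid [::]) | exact: symmetric_neq0 sy1].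
  move: (t1 ++ m ++ t2) sy g us => s sy g us {t1 m t2 sy1 i1}.
  have [w st _] := (symmetricE _ _).1 sy; case: s sy g us w st => // a s _ /andP[ga gs] us w _.
  move: us; rewrite subw_cat subnK // ei' => /infixP[u1 [u2]].
  rewrite Fw_cons -catA catA => /cat_inj_size h; have {h} [|r [_ er]] := h.
    by rewrite size_cat size_subw; apply: leq_trans (front_bound _ _) (leq_addl _ _).
  have [_ /(_ ga s w gs) per] := fP a.
  have perP : has_period P (fl S' s).
    by rewrite /P (bigD1 a) //= mulnC; apply: has_period_mul.
  have := perP (W 0) (size r + i); rewrite er !nth_cat !size_cat size_subw.
  have -> : size r + i + P < size r = false by lia.
  have -> : size r + i < size r = false by lia.
  have -> : size r + i + P - size r = i + P by lia.
  have -> : size r + i - size r = i by lia.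
  have -> : i + P < n by rewrite /n.
  have -> : i < n by rewrite /n; lia.
  by rewrite !nth_subw ?add0n /n; [apply; lia | lia | lia].
clearbody P; exists (mkseq W P); split; first by move/(congr1 size); rewrite size_mkseq => P00; rewrite P00 in P0.
move=> i; rewrite size_mkseq nth_mkseq ?ltn_pmod // {1}(divn_eq i P).
elim: (i %/ P) => // k IH.
by have -> : k.+1 * P + i %% P = k * P + i %% P + P; [lia | rewrite perW].
Qed.
End NoPersistent.

End Evolution.

Theorem theorem4p1 (A : eqType) (V E : finType) (S : gwords A V E) (W : nat -> A) (v : E) :
  recurrent W -> rauzy_scheme S W -> support_edge (gr S) v ->
  strongly_connected (S2graph S W v) /\
  (is_cycle (S2graph S W v) -> periodic W) /\
  (~ is_cycle (S2graph S W v) ->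
     (forall e, exists s, natRext (S2graph S W v) e s) /\
     (forall e, exists s, natLext (S2graph S W v) e s) /\
     forall Fr Bk : E2 S W v -> seq A,
       (forall e s, natRext (S2graph S W v) e s -> Fr e = Fw (S1 S v) (unfold2 s)) ->
       (forall e s, natLext (S2graph S W v) e s -> Bk e = Bw (S1 S v) (unfold2 s)) ->
       rauzy_scheme (GW (S2graph S W v) Fr Bk) W).
Proof.
move=> rec scheme supp; split; first exact: strongly_connected2.
split=> [cyc | nc].
  exact: periodic_of_transient rec scheme supp (cycle_no_persistent rec scheme supp cyc).
have [x px] := persistent_of_not_cycle rec scheme supp nc; pose x0 : V2 S W v := exist _ x px.
have [fV fE] := (finite_vertices2 S W v, finite_edges2 S W v).
have deg := vertex_cases2 rec scheme supp; have sc := strongly_connected2 rec scheme supp.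
split; first by move=> e; apply: natRext_exists.
split; first by move=> e; apply: natLext_exists.
by move=> Fr Bk FrE BkE; apply: (rauzy_scheme2 rec scheme supp x0).
Qed.
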